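(* Let $\Gamma=\{1,\dots,m\}$, let $f_\gamma:\mathbb{R}^n\to\mathbb{R}^n$ ($\gamma\in\Gamma$) be continuous, write $f(\xi,\gamma)=f_\gamma(\xi)$, and consider the switched system $\dot x=f(x,\sigma)$. Let $\mathcal{T}'$ be a family of maximal trajectories of this system, and let $\chi=\{\chi_\gamma:\gamma\in\Gamma\}$ be a closed covering of $\mathbb{R}^n$ such that $\mathcal{T}'\subseteq\mathcal{T}[\chi]$. Put $\Gamma^*=\{\gamma\in\Gamma: 0\in\chi_\gamma\}$ and assume $f(0,\gamma)=0$ for all $\gamma\in\Gamma^*$. Assume also $\mathcal{T}'\subseteq\mathcal{T}_a$. Suppose that there exists a weak Lyapunov-like function $V$ for $\mathcal{T}'$ such that $M=\{0\}\times\Gamma^*$ is the maximal weakly-invariant set with respect to $\mathcal{T}_V^*\cap\mathcal{T}[\chi]\cap\mathcal{T}_a$ (where $\mathcal{T}_V^*$ is taken with $\Omega=\mathbb{R}^n$). Then $\mathcal{T}'$ is globally asymptotically stable. If, in addition, $\mathcal{T}'\subseteq\mathcal{T}_a[\tau_D,N_0]$ for some $\tau_D>0$ and some $N_0\in\mathbb{N}$, then $\mathcal{T}'$ is globally uniformly asymptotically stable.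
   Context: Notation: $\mathbb{R}_+=[0,\infty)$, $\mathbb{N}$ is the set of positive integers, $|\cdot|$ is the Euclidean norm. $\alpha:\mathbb{R}_+\to\mathbb{R}_+$ is of class $\mathcal{K}$ if it is continuous, strictly increasing and $\alpha(0)=0$; of class $\mathcal{K}_\infty$ if in addition unbounded. $\beta:\mathbb{R}_+\times\mathbb{R}_+\to\mathbb{R}_+$ is of class $\mathcal{KL}$ if it is of class $\mathcal{K}_\infty$ in the first argument and decreases to zero in the second. Switched system. $\Gamma$ carries the discrete metric. A switching signal is a piecewise constant, right-continuous function $\sigma:\mathbb{R}_+\to\Gamma$. Its switching times are $t_0=0$ and its consecutive discontinuities $t_1<t_2<\cdots$ (finitely many, or infinitely many tending to $\infty$). A solution of $\dot x=f(x,\sigma)$ corresponding to $\sigma$ is a (continuous) piecewise smooth curve $x:\mathcal{I}\to\mathbb{R}^n$, $\mathcal{I}=[0,T)$ or $[0,T]$, $0<T\le\infty$, with $\dot x(t)=f(x(t),\sigma(t))$ for all $t\in(t_i,t_{i+1})\cap\mathcal{I}$ and all $i$ (with $t_{i+1}=\infty$ if $t_i$ is the last switching time). A trajectory is a pair $(x,\sigma)$ with $x$ a solution corresponding to $\sigma$; it is maximal if $x$ is a maximal (non-extendable) solution, and its domain is then $\mathcal{I}_{(x,\sigma)}=[0,t_{(x,\sigma)})$. $\mathcal{T}$ is the set of all maximal trajectories. (If $x$ is bounded then $t_{(x,\sigma)}=\infty$.) A closed covering of $\mathbb{R}^n$ is a family $\chi=\{\chi_\gamma:\gamma\in\Gamma\}$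 of closed sets with $\bigcup_\gamma\chi_\gamma=\mathbb{R}^n$. $\mathcal{T}[\chi]$ is the set of $(x,\sigma)\in\mathcal{T}$ with $x(t)\in\chi_{\sigma(t)}$ for all $t\in\mathcal{I}_{(x,\sigma)}$. Average dwell-time. $\sigma$ has average dwell-time $\tau_D>0$ and chatter bound $N_0\in\mathbb{N}$ if the number of switching times of $\sigma$ in any open finite interval $(\tau_1,\tau_2)\subset\mathbb{R}_+$ is at most $N_0+(\tau_2-\tau_1)/\tau_D$. $\mathcal{S}_a[\tau_D,N_0]$ is the set of such signals, $\mathcal{T}_a[\tau_D,N_0]$ the set of $(x,\sigma)\in\mathcal{T}$ with $\sigma\in\mathcal{S}_a[\tau_D,N_0]$, and $\mathcal{T}_a=\bigcup_{\tau_D>0,N_0\in\mathbb{N}}\mathcal{T}_a[\tau_D,N_0]$. Stability. A family $\mathcal{T}'$ of maximal trajectories is: uniformly stable if there is $\alpha\in\mathcal{K}_\infty$ such that for every $(x,\sigma)\in\mathcal{T}'$, $|x(t)|\le\alpha(|x(t_0)|)$ for all $t\ge t_0\ge0$ (including that $x$ is defined on $[0,\infty)$); globally asymptotically stable if it is uniformly stable and $x(t)\to0$ as $t\to\infty$ for every $(x,\sigma)\in\mathcal{T}'$; globally uniformly asymptotically stable if there is $\beta\in\mathcal{KL}$ such that for every $(x,\sigma)\in\mathcal{T}'$, $|x(t)|\le\beta(|x(t_0)|,t-t_0)$ for all $t\ge t_0\ge0$. Weak Lyapunov-like function for $\mathcal{T}'$ (with the covering $\chi$): a function $V:\mathbb{R}^n\times\Gamma\to\mathbb{R}$,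 continuously differentiable in the first argument, such that (1) there are $\alpha_1,\alpha_2\in\mathcal{K}_\infty$ with $\alpha_1(|\xi|)\le V(\xi,\gamma)\le\alpha_2(|\xi|)$ for all $(\xi,\gamma)$ with $\xi\in\chi_\gamma$; (2) $\frac{\partial V}{\partial\xi}(\xi,\gamma)f(\xi,\gamma)\le0$ for all $(\xi,\gamma)$ with $\xi\in\chi_\gamma$; (3) for every $(x,\sigma)\in\mathcal{T}'$ and any switching times $t_i<t_j$ of $\sigma$ (in the domain of $x$) with $\sigma(t_i)=\sigma(t_j)$, $V(x(t_j),\sigma(t_j))\le V(x(t_{i+1}),\sigma(t_i))$. Families associated with $V$. For continuous $V:\Omega\times\Gamma\to\mathbb{R}$, $\Omega\subseteq\mathbb{R}^n$ open, $\mathcal{T}_V$ is the set of $(x,\sigma)\in\mathcal{T}$ such that $x(t)\in\Omega$ for all $t\in\mathcal{I}_{(x,\sigma)}$ and $V(x(t),\sigma(t))\ge V(x(t'),\sigma(t'))$ whenever $t\le t'$ in $\mathcal{I}_{(x,\sigma)}$ and $\sigma(t)=\sigma(t')$. $\mathcal{T}_V^*$ is the set of $(x,\sigma)\in\mathcal{T}_V$ such that $\sigma(t)=\sigma(t')$ implies $V(x(t),\sigma(t))=V(x(t'),\sigma(t'))$, for $t,t'\in\mathcal{I}_{(x,\sigma)}$. Weak invariance. For a family $\mathcal{T}^*$ of maximal trajectories, a nonempty $M\subseteq\mathbb{R}^n\times\Gamma$ is weakly-invariant with respect to $\mathcal{T}^*$ if for each $(\xi,\gamma)\in M$ there is $(x,\sigma)\in\mathcal{T}^*$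 with $x(0)=\xi$, $\sigma(0)=\gamma$ and $(x(t),\sigma(t))\in M$ for all $t\in\mathcal{I}_{(x,\sigma)}$. ''Maximal'' is with respect to inclusion (largest such set). *)

(* Defs.v *)
From mathcomp Require Import all_boot all_order all_algebra.
From mathcomp Require Import all_classical all_reals all_analysis.

Set Implicit Arguments.
Unset Strict Implicit.
Unset Printing Implicit Defensive.

Import Order.TTheory GRing.Theory Num.Theory.
Import numFieldNormedType.Exports.

Local Open Scope classical_set_scope.
Local Open Scope ring_scope.

(** Functions on R_+ = [0, +oo) are represented by functions on R whose values
    at negative arguments are never used. *)

Section ComparisonFunctions.
Context {R : realType}.

Definition class_K (a : R -> R) : Prop :=
  [/\ {within `[0, +oo[, continuous a},
      forall r s, 0 <= r -> r < s -> a r < a s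
    & a 0 = 0].

Definition class_Kinf (a : R -> R) : Prop :=
  class_K a /\ forall B, exists2 r, 0 <= r & B < a r.

(** "Decreases to zero" is read as nonincreasing with limit 0, since
    [b 0 t = 0] for all [t]. *)
Definition class_KL (b : R -> R -> R) : Prop :=
  [/\ forall t, 0 <= t -> class_Kinf (b ^~ t),
      forall r, 0 <= r -> forall s t, 0 <= s -> s <= t -> b r t <= b r s
    & forall r, 0 <= r -> b r t @[t --> +oo] --> 0].

End ComparisonFunctions.

(** The norm of ['rV[R]_n] in the library is the maximum norm; it induces the
    same topology. *)
Definition enorm {R : realType} {n : nat} (v : 'rV[R]_n) : R :=
  Num.sqrt (\sum_i v 0 i ^+ 2).

Section SwitchingSignals.
Context {R : realType} {m : nat}.
Implicit Types s : R -> 'I_m.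

(** Near continuity statements are for the discrete metric on ['I_m]. *)
Definition right_continuous_signal s : Prop :=
  forall t, 0 <= t -> \forall u \near t^'+, s u = s t.

Definition piecewise_constant s : Prop :=
  forall T, 0 < T -> exists2 B : set R, finite_set B &
    forall a b, 0 <= a -> b <= T -> `]a, b[ `&` B = set0 ->
      forall u v, `]a, b[%classic u -> `]a, b[%classic v -> s u = s v.

Definition switching_signal s : Prop :=
  piecewise_constant s /\ right_continuous_signal s.

(** A right-continuous signal is continuous at 0 relatively to R_+, so its
    discontinuities are positive. *)
Definition switching_time s (t : R) : Prop :=
  t = 0 \/ (0 < t /\ ~ (\forall u \near t, s u = s t)).

Definition next_switching_time s (t t' : R) : Prop :=
  [/\ switching_time s t, switching_time s t', t < t'
    & forall u, t < u -> u < t' -> ~ switching_time s u].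

Definition average_dwell_time (tauD : R) (N0 : nat) s : Prop :=
  forall t1 t2, 0 <= t1 -> t1 < t2 ->
    exists2 k : nat, ([set t | switching_time s t /\ t1 < t < t2] #= `I_k)%card
      & k%:R <= N0%:R + (t2 - t1) / tauD.

Definition adt_signals (tauD : R) (N0 : nat) : set (R -> 'I_m) :=
  [set s | switching_signal s /\ average_dwell_time tauD N0 s].

End SwitchingSignals.

(** A curve with its time domain (values of [state] outside [dom] are never
    used) together with a signal. *)
Record trajectory (R : realType) (n m : nat) := Trajectory {
  dom : set R;
  state : R -> 'rV[R]_n;
  signal : R -> 'I_m }.

Section SwitchedSystem.
Context {R : realType} {n m : nat}.
Variable f : 'I_m -> 'rV[R]_n -> 'rV[R]_n.
Implicit Types (I J : set R) (x y : R -> 'rV[R]_n) (s : R -> 'I_m)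
  (p : trajectory R n m).

Definition time_domain I : Prop :=
  [\/ exists2 T, 0 < T & I = `[0, T[%classic,
      exists2 T, 0 < T & I = `[0, T]%classic
    | I = `[0, +oo[%classic].

(** The derivative is relative to [I], hence one-sided at the right end of a
    closed domain. *)
Definition has_derivative_within I x (t : R) (v : 'rV[R]_n) : Prop :=
  (u - t)^-1 *: (x u - x t) @[u --> within I t^'] --> v.

(** The points of R_+ that are not switching times form the union of the
    intervals (t_i, t_{i+1}).  For continuous [f], [x] is then automatically
    C^1 on each of these intervals, with one-sided limits of its derivative at
    their endpoints in [I], i.e. piecewise smooth. *)
Definition solution I x s : Prop :=
  [/\ time_domain I,
      {within I, continuous x}
    & forall t, I t -> ~ switching_time s t ->
        has_derivative_within I x t (f (s t) (x t))].

Definition maximal_solution I x s : Prop :=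
  solution I x s /\
  forall J y, solution J y s -> I `<=` J -> (forall t, I t -> y t = x t) ->
    J = I.

Definition maximal_trajectories : set (trajectory R n m) :=
  [set p | switching_signal (signal p) /\
           maximal_solution (dom p) (state p) (signal p)].

Definition closed_covering (chi : 'I_m -> set 'rV[R]_n) : Prop :=
  (forall g, closed (chi g)) /\ \bigcup_g chi g = setT.

Definition covered_trajectories (chi : 'I_m -> set 'rV[R]_n) :=
  [set p | maximal_trajectories p /\
           forall t, dom p t -> chi (signal p t) (state p t)].

Definition adt_trajectories (tauD : R) (N0 : nat) :=
  [set p | maximal_trajectories p /\ adt_signals tauD N0 (signal p)].

Definition all_adt_trajectories : set (trajectory R n m) :=
  [set p | exists tauD N0,
     [/\ 0 < tauD, (0 < N0)%N & adt_trajectories tauD N0 p]].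

Definition monotone_trajectories (Omega : set 'rV[R]_n)
    (V : 'I_m -> 'rV[R]_n -> R) :=
  [set p | [/\ maximal_trajectories p,
      forall t, dom p t -> Omega (state p t)
    & forall t t', dom p t -> dom p t' -> t <= t' ->
        signal p t = signal p t' ->
        V (signal p t') (state p t') <= V (signal p t) (state p t)]].

Definition level_trajectories (Omega : set 'rV[R]_n)
    (V : 'I_m -> 'rV[R]_n -> R) :=
  [set p | monotone_trajectories Omega V p /\
    forall t t', dom p t -> dom p t' -> signal p t = signal p t' ->
      V (signal p t) (state p t) = V (signal p t') (state p t')].

Definition C1 (W : 'rV[R]_n -> R) : Prop :=
  (forall xi, differentiable W xi) /\
  (forall v, continuous (fun xi => 'd W xi v)).

Definition weak_lyapunov_like (TT : set (trajectory R n m))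
    (chi : 'I_m -> set 'rV[R]_n) (V : 'I_m -> 'rV[R]_n -> R) : Prop :=
  [/\ forall g, C1 (V g),
      exists a1 a2, [/\ class_Kinf a1, class_Kinf a2 &
        forall xi g, chi g xi ->
          a1 (enorm xi) <= V g xi /\ V g xi <= a2 (enorm xi)],
      forall xi g, chi g xi -> 'd (V g) xi (f g xi) <= 0
    & forall p, TT p -> forall ti ti1 tj,
        next_switching_time (signal p) ti ti1 ->
        switching_time (signal p) tj -> ti < tj -> dom p tj ->
        signal p ti = signal p tj ->
        V (signal p tj) (state p tj) <= V (signal p ti) (state p ti1)].

End SwitchedSystem.

Section Families.
Context {R : realType} {n m : nat}.
Implicit Types TT : set (trajectory R n m).

Definition weakly_invariant TT (M : set ('rV[R]_n * 'I_m)) : Prop :=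
  M !=set0 /\
  forall xi g, M (xi, g) -> exists2 p, TT p &
    [/\ state p 0 = xi, signal p 0 = g
      & forall t, dom p t -> M (state p t, signal p t)].

Definition maximal_weakly_invariant TT (M : set ('rV[R]_n * 'I_m)) : Prop :=
  weakly_invariant TT M /\ forall M', weakly_invariant TT M' -> M' `<=` M.

Definition uniformly_stable TT : Prop :=
  exists2 a : R -> R, class_Kinf a & forall p, TT p ->
    dom p = `[0, +oo[%classic /\
    forall t0 t, 0 <= t0 -> t0 <= t ->
      enorm (state p t) <= a (enorm (state p t0)).

Definition globally_asymptotically_stable TT : Prop :=
  uniformly_stable TT /\
  forall p, TT p -> state p t @[t --> +oo] --> (0 : 'rV[R]_n).

Definition globally_uniformly_asymptotically_stable TT : Prop :=
  exists2 b : R -> R -> R, class_KL b & forall p, TT p ->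
    dom p = `[0, +oo[%classic /\
    forall t0 t, 0 <= t0 -> t0 <= t ->
      enorm (state p t) <= b (enorm (state p t0)) (t - t0).

End Families.

(* Main.v *)
Require Import Defs.
From mathcomp Require Import all_boot all_order all_algebra finmap.
From mathcomp Require Import all_classical all_reals all_analysis.
From mathcomp Require Import ring lra zify.
Set Implicit Arguments.
Unset Strict Implicit.
Unset Printing Implicit Defensive.
Import Order.TTheory GRing.Theory Num.Theory.
Import numFieldNormedType.Exports.
Local Open Scope classical_set_scope.
Local Open Scope ring_scope.

(* In every mode V decreases along a trajectory, and the switching condition
   keeps it from growing while the mode is inactive.  Hence only the first visit
   of each of the m modes can worsen the bound on the state, each time by at most
   one application of alpha1^-1 o alpha2: this is uniform stability.
   Bounded maximal solutions are global because, by Peano's theorem, a solution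
   on a compact interval can be prolonged.

   If attraction were not uniform, time shifts of trajectories would stay in a
   fixed annulus around 0 for longer and longer times.  Their limit along a free
   ultrafilter is a trajectory in the annulus with the same average dwell-time
   bounds, and V is still nonincreasing in every mode.  The limit of the shifts
   of this trajectory to infinity has moreover V constant in every mode, so its
   orbit is weakly invariant and must be {0} x Gamma^*, which is not in the
   annulus. *)

(** * Switching signals *)

(** Switching times do not survive limits: they may merge or cancel. The dwell-time bound is
    therefore carried by an integer-valued counter, bounded at each time uniformly in the family and
    hence constant on a set of the ultrafilter. A single free ultrafilter yields limits of states,
    signals and counters at all times at once, with no diagonal subsequences; Lipschitz bounds,
    uniform because the states are bounded and the modes finitely many, give the equicontinuity of
    an Arzela-Ascoli argument.

    The signals are known to converge to the limit signal only just to the right of each time.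
    Membership in the covering and monotonicity of V are thus obtained at times slightly later than
    t and then carried back to t by continuity.

    Both halves of the theorem rest on one attractivity statement for families with common
    dwell-time constants: a single trajectory is such a family, which gives plain convergence. In
    the uniform case the comparison function is a supremum over the family, made continuous and
    strictly increasing by hand. *)

Section RealInduction.
Context {R : realType}.

(** The supremum of the times up to which [P] holds throughout satisfies [P] by the limit clause,
    and the step clause forbids it to lie below [b]. This handles intervals with several switching
    times without enumerating them. *)
Lemma real_induction (P : R -> Prop) (a b : R) :
  P a ->
  (forall t, a <= t -> t < b -> P t ->
     exists2 d, 0 < d & forall u, t < u -> u < t + d -> u <= b -> P u) ->
  (forall t, a < t -> t <= b -> (forall u, a <= u -> u < t -> P u) -> P t) ->
  forall t, a <= t -> t <= b -> P t.
Proof.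
move=> Pa step lim t0 at0 t0b.
pose E := [set w | a <= w /\ w <= b /\ forall u, a <= u -> u <= w -> P u].
have Ea : E a.
  split=> //; split; first exact: le_trans t0b.
  by move=> u au ua; have -> : u = a by apply/eqP; rewrite eq_le ua au.
have Eb : has_sup E by split; [exists a | exists b => w [_ []]].
have supE w : E w -> w <= sup E by move=> Ew; apply: ub_le_sup => //; case: Eb.
have asup : a <= sup E by exact: supE.
have supb : sup E <= b by apply: ge_sup; [exists a | move=> w [_ []]].
have lowP u : a <= u -> u < sup E -> P u.
  move=> au usup; have e0 : 0 < sup E - u by rewrite subr_gt0.
  have [w [aw [wb Pw]]] := sup_adherent e0 Eb.
  by rewrite subKr => uw; apply: Pw => //; apply: ltW.
have PsupE : P (sup E).
  move: asup; rewrite le_eqVlt => /predU1P[<-//|asup].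
  exact: lim.
have [supb'|] := ltP (sup E) b; last first.
  move=> bsup; have [t0s|st0] := ltP t0 (sup E); first exact: lowP.
  have -> // : t0 = sup E.
  by apply/eqP; rewrite eq_le st0 (le_trans t0b bsup).
have [d d0 dP] := step _ asup supb' PsupE.
exfalso.
pose w := Num.min b (sup E + d / 2).
have wsup : sup E < w by rewrite lt_min supb' ltrDl divr_gt0.
have Ew : E w.
  split; first by apply: le_trans (ltW wsup).
  split; first by rewrite ge_min lexx.
  move=> u au uw.
  have [us|su|->//] := ltgtP u (sup E); first exact: lowP.
  apply: dP => //.
    apply: (le_lt_trans uw); rewrite gt_min; apply/orP; right.
    by rewrite ltrD2l; lra.
  by apply: (le_trans uw); rewrite ge_min lexx.
by have := supE _ Ew; rewrite leNgt wsup.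
Qed.

End RealInduction.

Section Signals.
Context {R : realType} {m : nat}.
Implicit Types (s : R -> 'I_m) (t u v a b : R).

Lemma right_continuous_signalP s : right_continuous_signal s ->
  forall t, 0 <= t ->
  exists2 d, 0 < d & forall u, t <= u -> u < t + d -> s u = s t.
Proof.
move=> rs t t0; have [d /= d0 H] := rs t t0.
exists d => // u tu utd.
move: tu; rewrite le_eqVlt => /predU1P[->//|tu].
by apply: H => //=; rewrite ltr_distlC; apply/andP; split; lra.
Qed.

Lemma right_continuous_signalI s :
  (forall t, 0 <= t ->
  exists2 d, 0 < d & forall u, t <= u -> u < t + d -> s u = s t) ->
  right_continuous_signal s.
Proof.
move=> H t t0; have [d d0 dP] := H t t0.
exists d => //= u /=; rewrite ltr_distlC => /andP[_ utd] tu.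
by apply: dP => //; apply: ltW.
Qed.

(** The time 0 is excluded because it counts as a switching time of every signal. *)
Lemma not_switching_timeP s t : 0 < t -> ~ switching_time s t <->
  exists2 d, 0 < d & forall u, `|u - t| < d -> s u = s t.
Proof.
move=> t0; split.
  move=> nst; have /contrapT[d /= d0 H] : ~ ~ (\forall u \near t, s u = s t).
    by move=> nn; apply: nst; right.
  by exists d => // u; rewrite distrC; exact: H.
move=> [d d0 H] [t0'|[_]]; first by rewrite t0' ltxx in t0.
by apply; exists d => //= u /=; rewrite distrC; exact: H.
Qed.

Lemma switching_time_ge0 s t : switching_time s t -> 0 <= t.
Proof. by case=> [->//|[/ltW]]. Qed.

Lemma constant_not_switching s a b :
  0 <= a -> (forall u, a <= u -> u < b -> s u = s a) ->
  forall t, a < t -> t < b -> ~ switching_time s t.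
Proof.
move=> a0 H t at_ tb; apply/not_switching_timeP; first exact: le_lt_trans at_.
exists (Num.min (t - a) (b - t)); first by rewrite lt_min !subr_gt0 at_.
move=> u; rewrite lt_min !ltr_distl => /andP[/andP[? ?] /andP[? ?]].
by rewrite !H //; lra.
Qed.

Lemma constant_between_switching s a b : right_continuous_signal s -> 0 <= a ->
  (forall t, a < t -> t <= b -> ~ switching_time s t) ->
  forall t, a <= t -> t <= b -> s t = s a.
Proof.
move=> rs a0 ns; apply: (real_induction (P := fun t => s t = s a)) => //.
  move=> t at_ tb sta; have [|d d0 dP] := right_continuous_signalP rs (t := t).
    exact: le_trans at_.
  by exists d => // u tu utd _; rewrite -sta; apply: dP => //; apply: ltW.
move=> t at_ tb H.
have [d d0 dP] : exists2 d, 0 < d & forall u, `|u - t| < d -> s u = s t.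
  apply/not_switching_timeP; first exact: le_lt_trans at_.
  exact: ns.
have [e /andP[? ?]] : exists e, (Num.max a (t - d) <= e) && (e < t).
  exists ((Num.max a (t - d) + t) / 2).
  have : Num.max a (t - d) < t by rewrite gt_max at_ /=; lra.
  by move=> ?; apply/andP; split; lra.
have ae : a <= e by apply: le_trans (_ : Num.max a (t - d) <= _); rewrite ?le_max ?lexx.
have tde : t - d <= e by apply: le_trans (_ : Num.max a (t - d) <= _); rewrite ?le_max ?lexx ?orbT.
have te : t - d < (e + t)/2 by lra.
rewrite -(H ((e + t)/2)); [|lra|lra]; apply/esym/dP.
by rewrite ltr_distl; apply/andP; split; lra.
Qed.

(** The witness is the infimum of the times since which the signal has kept the value [s t].
    Right-continuity shows that it is attained; if it were positive and not a switching time, the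
    constant stretch would extend further to the left. *)
Lemma last_switching_time s t : right_continuous_signal s -> 0 <= t ->
  exists c, [/\ switching_time s c, c <= t &
     forall u, c < u -> u <= t -> ~ switching_time s u].
Proof.
move=> rs t0.
pose E := [set w | 0 <= w /\ w <= t /\ forall u, w <= u -> u <= t -> s u = s t].
have Et : E t.
  split=> //; split=> // u tu ut.
  by have -> : u = t by apply/eqP; rewrite eq_le ut tu.
have Elb : has_inf E by split; [exists t | exists 0 => w []].
have infE w : E w -> inf E <= w by move=> Ew; apply: ge_inf => //; case: Elb.
have inf0 : 0 <= inf E by apply: lb_le_inf; [exists t | move=> w []].
have inft : inf E <= t by exact: infE.
have lowP u : inf E < u -> u <= t -> s u = s t.
  move=> au usup; have e0 : 0 < u - inf E by rewrite subr_gt0.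
  have [w [aw [wb Pw]]] := inf_adherent e0 Elb.
  by rewrite subrKC => uw; apply: Pw => //; apply: ltW.
have PinfE : s (inf E) = s t.
  have [->//|it] := eqVneq (inf E) t.
  have {}it : inf E < t by rewrite lt_neqAle it.
  have [d d0 dP] := right_continuous_signalP rs inf0.
  rewrite -(dP (Num.min t (inf E + d / 2))).
  - apply: lowP; last by rewrite ge_min lexx.
    by rewrite lt_min it /=; lra.
  - by rewrite le_min inft /=; lra.
  - by rewrite gt_min; apply/orP; right; lra.
exists (inf E); split => //.
- have [->|i0] := eqVneq (inf E) 0; first by left.
  have {}i0 : 0 < inf E by rewrite lt_neqAle eq_sym i0.
  apply: contrapT => /(not_switching_timeP _ i0)[d d0 dP].
  have : E (Num.max 0 (inf E - d / 2)).
    split; first by rewrite le_max lexx.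
    split; first by rewrite ge_max t0 /=; lra.
    move=> u; rewrite ge_max => /andP[u0 ud] ut.
    have [iu|ui] := ltP (inf E) u; first exact: lowP.
    by rewrite -PinfE; apply: dP; rewrite ltr_distl; apply/andP; split; lra.
  move=> /infE; rewrite le_max => /orP[|]; lra.
- move=> u iu ut.
  have [d d0 dP] := right_continuous_signalP rs t0.
  apply: (@constant_not_switching _ (inf E) (t + d)) => //; last lra.
  move=> v; rewrite le_eqVlt => /predU1P[<-//|iv] vtd.
  have [vt|tv] := leP v t; first by rewrite lowP.
  by rewrite dP //; exact: ltW.
Qed.

(** Right-continuity keeps switching times away from the right of [t], so the infimum of the later
    ones exceeds [t]. If it were not a switching time itself, a whole neighbourhood of it would
    contain none. *)
Lemma next_switching_time_after s t tj : right_continuous_signal s -> 0 <= t ->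
  t < tj -> switching_time s tj ->
  exists c, [/\ switching_time s c, t < c, c <= tj &
     forall u, t < u -> u < c -> ~ switching_time s u].
Proof.
move=> rs t0 ttj stj.
pose E := [set w | t < w /\ switching_time s w].
have Etj : E tj by [].
have Elb : has_inf E by split; [exists tj | exists t => w [/ltW]].
have infE w : E w -> inf E <= w by move=> Ew; apply: ge_inf => //; case: Elb.
have inftj : inf E <= tj by exact: infE.
have tinf : t < inf E.
  have [d d0 dP] := right_continuous_signalP rs t0.
  apply: (@lt_le_trans _ _ (t + d)); first lra.
  apply: lb_le_inf; first by exists tj.
  move=> w [tw sw]; rewrite leNgt; apply/negP => wtd.
  exact: (@constant_not_switching s t (t + d)) sw.
have i0 : 0 < inf E by exact: le_lt_trans tinf.
have nsE u : t < u -> u < inf E -> ~ switching_time s u.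
  by move=> tu ui su; have := infE u (conj tu su); rewrite leNgt ui.
exists (inf E); split => //.
apply: contrapT => /(not_switching_timeP _ i0)[d d0 dP].
have e0 : 0 < d by [].
have [w [tw sw] wd] := inf_adherent e0 Elb.
have iw : inf E <= w by exact: infE.
have i'w : (Num.max 0 (inf E - d / 2)) < w.
  by rewrite gt_max (lt_le_trans i0 iw) /=; lra.
apply: (@constant_not_switching s (Num.max 0 (inf E - d / 2)) (inf E + d)) sw => //.
  by rewrite le_max lexx.
move=> u; rewrite ge_max => /andP[u0 ud] uid.
have [? ?] : inf E - d < Num.max 0 (inf E - d / 2) /\
    Num.max 0 (inf E - d / 2) <= inf E.
  split; first by rewrite lt_max; apply/orP; right; lra.
  by rewrite ge_max (ltW i0) /=; lra.
by rewrite !dP // ltr_distl; apply/andP; split; lra.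
Qed.

End Signals.

(** * Counters of switching times *)

Section JumpCount.
Context {R : realType} {m : nat}.
Implicit Types (s : R -> 'I_m) (t u v a b tau : R) (N : R -> nat).

(* A counter of the switching times that survives time shifts and pointwise
   limits, unlike the switching times themselves. *)
Definition jump_count tau (N0 : nat) s N :=
  [/\ forall u v, 0 <= u -> u <= v -> (N u <= N v)%N,
      forall u v, 0 <= u -> u <= v -> N u = N v -> s u = s v
    & forall u v, 0 <= u -> u <= v ->
        (N v)%:R <= (N u)%:R + (N0%:R + (v - u) / tau)].

(** The counter is the number of switching times in []0, u]], time 0 being left out. *)
Lemma adt_jump_count tau (N0 : nat) s : 0 < tau -> adt_signals tau N0 s ->
  exists N, jump_count tau N0 s N.
Proof.
move=> tau0 [[_ rs] adt].
pose S u := [set t | switching_time s t /\ 0 < t <= u].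
have finS u : finite_set (S u).
  have [u0|u0] := ltP 0 (u + 1); last first.
    rewrite (_ : S u = set0) //; apply/seteqP; split=> // t [_ /andP[? ?]].
    by have : t < t; [lra|rewrite ltxx].
  have [k Sk _] := adt _ _ (lexx 0) u0.
  have : finite_set [set t | switching_time s t /\ 0 < t < u + 1].
    by apply/finite_setP; exists k.
  by apply: sub_finite_set => t [st /andP[t0 tu]]; split=> //; rewrite t0 /=; lra.
have leS u v : u <= v -> S u `<=` S v.
  by move=> uv t [st /andP[t0 tu]]; split=> //; rewrite t0 (le_trans tu uv).
have leN u v : u <= v -> (#|` fset_set (S u)| <= #|` fset_set (S v)|)%N.
  by move=> uv; apply: fsubset_leq_card; rewrite -fset_set_sub //; exact: leS.
have NB u v : u <= v -> #|` fset_set (S v)| =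
    (#|` fset_set (S u)| + #|` fset_set (S v `\` S u)|)%N.
  move=> uv; rewrite fset_setD // cardfsD.
  rewrite (fsetIidPr _); first by rewrite subnKC // leN.
  by rewrite -fset_set_sub //; exact: leS.
exists (fun u => #|` fset_set (S u)|); split.
- by move=> u v u0 uv; exact: leN.
- move=> u v u0 uv; rewrite (NB u v) // => /eqP.
  rewrite -[X in X == _]addn0 eqn_add2l eq_sym cardfs_eq0 => /eqP SD.
  have {}SD : S v `\` S u = set0.
    by rewrite -(fset_setK (finite_setD (S u) (finS v))) SD; apply/seteqP; split.
  apply/esym; apply: (@constant_between_switching _ _ s u v) => //.
  move=> t ut tv st; have : (S v `\` S u) t.
    split; first by split => //; rewrite tv (le_lt_trans u0 ut).
    by move=> [_ /andP[_]]; rewrite leNgt ut.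
  by rewrite SD.
(* Average dwell-time speaks of open intervals, the counter of []u, v]]. Prolonging the interval by
   [e * tau] captures a switch at [v] and costs only [e]. *)
- move=> u v u0 uv; apply/ler_addgt0Pr => e e0.
  have [|k Sk kle] := adt u (v + e * tau) u0.
    by rewrite (le_lt_trans uv) // ltrDl mulr_gt0.
  rewrite -addrA; have -> : N0%:R + (v - u) / tau + e = N0%:R + (v + e * tau - u) / tau.
    by field; rewrite gt_eqF.
  rewrite (NB u v) // natrD lerD2l; apply: le_trans kle.
  rewrite ler_nat -(card_fset_set Sk); apply: fsubset_leq_card.
  rewrite -fset_set_sub; last 2 first.
  + by apply: finite_setD.
  + by apply/finite_setP; exists k.
  move=> t [[st /andP[t0 tv]] nSu]; split=> //; apply/andP; split.
    rewrite ltNge; apply/negP => tu; apply: nSu; split=> //.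
    by rewrite t0.
  by rewrite (le_lt_trans tv) // ltrDl mulr_gt0.
Qed.

(** With equal counters the signal would be constant on [[u, t]] and, by right-continuity, slightly
    beyond, so [t] could not be a switching time. *)
Lemma jump_count_switching tau (N0 : nat) s N t u : right_continuous_signal s ->
  jump_count tau N0 s N -> 0 <= u -> u < t -> switching_time s t ->
  (N u < N t)%N.
Proof.
move=> rs [N1 N2 _] u0 ut st; rewrite ltn_neqAle N1 // ?(ltW ut) // andbT.
apply/eqP => NE.
have t0 : 0 <= t by apply: le_trans (ltW ut).
have [d d0 dP] := right_continuous_signalP rs t0.
apply: (@constant_not_switching _ _ s u (t + d)) st => //; last by lra.
move=> w uw wtd; have [wt|tw] := leP w t; last first.
  by rewrite dP // ?ltW // -(N2 _ _ u0 _ NE) // ltW.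
apply/esym/N2 => //; apply/eqP; rewrite eqn_leq N1 //= NE N1 //.
exact: le_trans uw.
Qed.

(** Converse of [adt_jump_count], by which a limit signal regains its dwell-time bound. A counter
    may also jump where the signal does not, so it only bounds the number of switches from above. *)
Lemma jump_count_adt tau (N0 : nat) s N : right_continuous_signal s ->
  jump_count tau N0 s N -> adt_signals tau N0 s.
Proof.
move=> rs jc; have [N1 N2 N3] := jc.
have lejump a b : 0 <= a -> a < b ->
   ([set t | switching_time s t /\ a < t <= b] #<= `I_(N b - N a))%card.
  (* The counter strictly increases at switching times and exceeds [N a] at those after [a]; hence
     the numbering is injective and its subtraction never truncates. *)
  move=> a0 ab; apply/pcard_leP/injfunPex; exists (fun t => (N t - (N a).+1)%N).
    move=> t [st /andP[at_ tb]] /=.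
    have := jump_count_switching rs jc a0 at_ st.
    by have := N1 t b (le_trans a0 (ltW at_)) tb; lia.
  move=> t t' /set_mem[st /andP[at_ tb]] /set_mem[st' /andP[at' tb']].
  have := jump_count_switching rs jc a0 at_ st.
  have := jump_count_switching rs jc a0 at' st'.
  have [lt_tt'|lt_t't|//] := ltgtP t t'.
    by have := jump_count_switching rs jc (le_trans a0 (ltW at_)) lt_tt' st'; lia.
  by have := jump_count_switching rs jc (le_trans a0 (ltW at')) lt_t't st; lia.
split; last first.
  move=> a b a0 ab.
  have leI : ([set t | switching_time s t /\ a < t < b] #<= `I_(N b - N a))%card.
    apply: card_le_trans (lejump a b a0 ab); apply: subset_card_le.
    by move=> t [st /andP[at_ tb]]; split=> //; rewrite at_ ltW.
  have /finite_setP[k Sk] := card_le_finite leI (finite_II _).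
  exists k => //; apply: (@le_trans _ _ (N b - N a)%:R).
    by rewrite ler_nat -card_le_II -(card_le_eql Sk).
  by have ab' := ltW ab; rewrite natrB ?N1 // lerBlDl N3.
split=> // T T0.
exists [set t | switching_time s t /\ 0 < t <= T].
  exact: card_le_finite (lejump 0 T (lexx 0) T0) (finite_II _).
move=> a b a0 bT I0.
have K u v : a < u -> u <= v -> v < b -> s v = s u.
  move=> au uv vb.
  apply: (@constant_between_switching _ _ s u v) => //; first by lra.
  move=> t ut tv st; suff : (`]a, b[ `&` [set t | switching_time s t /\ 0 < t <= T]) t.
    by rewrite I0.
  by split; [rewrite /= in_itv /=; apply/andP; split; lra | split=> //; lra].
move=> u v; rewrite /= !in_itv /= => /andP[au ub] /andP[av vb].
have [uv|vu] := leP u v; first by rewrite (K u v).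
by rewrite (K v u) // ltW.
Qed.

Lemma jump_count_shift tau (N0 : nat) s N a : 0 <= a -> jump_count tau N0 s N ->
  jump_count tau N0 (fun t => s (a + t)) (fun t => N (a + t)).
Proof.
move=> a0 [N1 N2 N3]; split=> u v u0 uv.
- by apply: N1; lra.
- by apply: N2; lra.
- by rewrite (le_trans (N3 (a+u) (a+v) _ _)); [|lra|lra|]; rewrite // opprD addrACA subrr add0r.
Qed.

Lemma right_continuous_shift s a : 0 <= a -> right_continuous_signal s ->
  right_continuous_signal (fun t => s (a + t)).
Proof.
move=> a0 rs; apply: right_continuous_signalI => t t0.
have [|d d0 dP] := @right_continuous_signalP _ _ s rs (a + t); first by lra.
by exists d => // u tu utd; apply: dP; lra.
Qed.

End JumpCount.

(** * Mean value estimates and solutions *)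

Section EpsilonDelta.
Context {R : realType} {W : normedModType R}.
Implicit Types (I : set R) (x : R -> W) (t : R).

Definition cont_at I x t := forall e, 0 < e ->
  exists2 d, 0 < d & forall u, I u -> `|u - t| < d -> `|x u - x t| <= e.

(** The remainder form of the derivative relative to [I]: it involves no division and is trivially
    true at [u = t]. *)
Definition deriv_at I x t (v : W) := forall e, 0 < e ->
  exists2 d, 0 < d & forall u, I u -> `|u - t| < d ->
    `|x u - x t - (u - t) *: v| <= e * `|u - t|.

Lemma within_continuousP I x :
  {within I, continuous x} <-> forall t, I t -> cont_at I x t.
Proof.
split.
  move=> /subspace_continuousP H t It e e0.
  have /cvgrPdist_le/(_ _ e0)[d /= d0 dP] := H t It.
  exists d => // u Iu ut; rewrite distrC; apply: dP => //=.
  by rewrite distrC.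
move=> H; apply/subspace_continuousP => t It.
apply/cvgrPdist_le => e e0; have [d d0 dP] := H t It e e0.
exists d => //= u ut Iu; rewrite distrC; apply: dP => //.
by rewrite distrC.
Qed.

Lemma continuous_cont_at (h : W -> W) (p : W) : {for p, continuous h} ->
  forall e, 0 < e -> exists2 d, 0 < d & forall q, `|q - p| <= d -> `|h q - h p| <= e.
Proof.
move=> hp e e0; have /cvgrPdist_le/(_ _ e0)/nbhs_ballP[d /= d0 dP] := hp.
exists (d / 2); first by rewrite divr_gt0.
move=> q qp; rewrite distrC; apply: dP; rewrite -ball_normE /=.
by rewrite distrC; apply: le_lt_trans qp _; rewrite ltr_pdivrMr // ltr_pMr // ltr1n.
Qed.

End EpsilonDelta.

Section DerivWithin.
Context {R : realType} {n : nat}.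
Implicit Types (I : set R) (x : R -> 'rV[R]_n) (t : R).

Lemma has_derivative_withinP I x t v :
  has_derivative_within I x t v <-> deriv_at I x t v.
Proof.
split.
  move=> /cvgrPdist_le H e e0.
  have [d /= d0 dP] := H e e0.
  exists d => // u Iu; have [->|ut] := eqVneq u t.
    by rewrite !subrr scale0r subrr !normr0 mulr0.
  move=> utd; have := dP u _ ut Iu; rewrite /= distrC => /(_ utd) {}dP.
  have ut0 : u - t != 0 by rewrite subr_eq0.
  have -> : x u - x t - (u - t) *: v = - ((u - t) *: (v - (u - t)^-1 *: (x u - x t))).
    by rewrite scalerBr scalerA divff // scale1r opprB.
  by rewrite normrN normrZ mulrC ler_pM2r // normr_gt0.
move=> H; apply/cvgrPdist_le => e e0; have [d d0 dP] := H e e0.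
exists d => //= u utd0 ut Iu.
have utd : `|u - t| < d by rewrite distrC.
have ut0 : u - t != 0 by rewrite subr_eq0.
have := dP u Iu utd.
have -> : x u - x t - (u - t) *: v = - ((u - t) *: (v - (u - t)^-1 *: (x u - x t))).
  by rewrite scalerBr scalerA divff // scale1r opprB.
by rewrite normrN normrZ mulrC ler_pM2r // normr_gt0.
Qed.

Context {m : nat} (f : 'I_m -> 'rV[R]_n -> 'rV[R]_n).

Lemma solutionP I x (s : R -> 'I_m) : solution f I x s <->
  [/\ time_domain I, forall t, I t -> cont_at I x t
    & forall t, I t -> ~ switching_time s t -> deriv_at I x t (f (s t) (x t))].
Proof.
split; move=> [tI cx dx]; split => //.
- exact/within_continuousP.
- by move=> t It ns; apply/has_derivative_withinP/dx.
- exact/within_continuousP.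
- by move=> t It ns; apply/has_derivative_withinP/dx.
Qed.

Lemma time_domain_ge0 I t : time_domain I -> I t -> 0 <= t.
Proof. by case=> [[T T0 ->]|[T T0 ->]|->]; rewrite /= in_itv /= ?andbT // => /andP[]. Qed.

Lemma time_domain_le I t u : time_domain I -> I t -> 0 <= u -> u <= t -> I u.
Proof.
case=> [[T T0 ->]|[T T0 ->]|->]; rewrite /= !in_itv /= ?andbT //.
- by move=> /andP[_ tT] -> ut /=; apply: le_lt_trans tT.
- by move=> /andP[_ tT] -> ut /=; apply: le_trans tT.
Qed.

End DerivWithin.

(** * Mean value inequality *)

Section IncrementBound.
Context {R : realType}.

(* Stated for an abstract cost [D] of intervals because it serves both for the
   norm of increments and for the decrease of [V] along solutions. *)
Lemma increment_le0 (D : R -> R -> R) (a b : R) : a < b ->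
  (forall t, D t t <= 0) ->
  (forall t u v, D t v <= D t u + D u v) ->
  (forall e, 0 < e -> exists2 d, 0 < d &
     forall t, a < t -> t < a + d -> t <= b -> D a t <= e) ->
  (forall t, a < t -> t <= b -> forall e, 0 < e -> exists2 d, 0 < d &
     forall u, a < u -> t - d < u -> u < t -> D u t <= e) ->
  (forall t, a < t -> t < b -> forall e, 0 < e -> exists2 d, 0 < d &
     forall u, t < u -> u < t + d -> u <= b -> D t u <= e * (u - t)) ->
  D a b <= 0.
Proof.
move=> ab D0 tri Da Dl Dr; apply/ler_addgt0Pr => e0 e0_gt0; rewrite add0r.
(* The budget [e0] equals [e + e * (b - a)]: one [e] for a short initial interval, the rest for a
   slope of at most [e] on the remainder. *)
pose e := e0 / (1 + (b - a)).
have ba : 0 < b - a by rewrite subr_gt0.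
have e_gt0 : 0 < e by rewrite divr_gt0 // addr_gt0.
have -> : e0 = e + e * (b - a) by rewrite /e; field; rewrite gt_eqF //; lra.
have [d d0 dP] := Da e e_gt0.
(* No slope estimate is assumed at [a] itself, so the induction starts at a point [c] just after
   it. *)
pose c := Num.min b (a + d / 2).
have [ac cb cad] : [/\ a < c, c <= b & c < a + d].
  rewrite /c lt_min ab ge_min lexx gt_min; split=> //=; first by lra.
  by apply/orP; right; lra.
apply: le_trans (tri a c b) _.
apply: lerD; first exact: dP.
apply: (@le_trans _ _ (e * (b - c))); last by rewrite ler_pM2l //; lra.
apply: (real_induction (P := fun t => D c t <= e * (t - c)) (a := c) (b := b)) => //.
- by rewrite /= subrr mulr0.
- move=> t ct tb Dct; have at_ : a < t by exact: lt_le_trans ct.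
  have [d' d'0 d'P] := Dr t at_ tb e e_gt0.
  exists d' => // u tu utd ub; apply: le_trans (tri c t u) _.
  have -> : e * (u - c) = e * (t - c) + e * (u - t) by ring.
  by rewrite lerD // d'P.
- move=> t ct tb H; have at_ : a < t by exact: lt_trans ct.
  apply/ler_addgt0Pr => e1 e1_gt0.
  have [d' d'0 d'P] := Dl t at_ tb e1 e1_gt0.
  pose u := Num.max ((c + t) / 2) (t - d' / 2).
  have [cu ut tu] : [/\ c < u, u < t & t - d' < u].
    rewrite /u !lt_max gt_max; split; first by apply/orP; left; lra.
      by apply/andP; split; lra.
    by apply/orP; right; lra.
  apply: le_trans (tri c u t) _; apply: lerD; last by apply: d'P => //; lra.
  apply: le_trans (H _ (ltW cu) ut) _.
  by rewrite ler_pM2l //; lra.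
Qed.

Context {W : normedModType R}.

(** The remainder [x u - x t - (u - t) *: w] is additive over adjacent intervals, so its norm minus
    [e * (u - t)] is a cost to which [increment_le0] applies. Derivatives are required in the open
    interval only, so the end points may be switching times. *)
Lemma mean_value_ineq (x : R -> W) (a b e : R) (w : W) : a <= b ->
  (forall t, a <= t -> t <= b -> cont_at `[a, b] x t) ->
  (forall t, a < t -> t < b ->
     exists2 v, deriv_at `[a, b] x t v & `|v - w| <= e) ->
  `|x b - x a - (b - a) *: w| <= e * (b - a).
Proof.
rewrite le_eqVlt => /predU1P[->|ab] cx dx.
  by rewrite !subrr scale0r subr0 normr0 mulr0.
rewrite -subr_le0.
pose D t u := `|x u - x t - (u - t) *: w| - e * (u - t).
have close t : a <= t -> t <= b -> forall e1, 0 < e1 -> exists2 d, 0 < d &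
  forall u, a <= u -> u <= b -> `|u - t| < d ->
  `|x u - x t| + `|u - t| * `|w| + `|e| * `|u - t| <= e1.
  move=> at_ tb e1 e10; have [|d d0 dP] := cx t at_ tb (e1 / 2); first lra.
  have C0 : 0 < `|w| + `|e| + 1 by rewrite ltr_wpDl // addr_ge0.
  exists (Num.min d (e1 / 2 / (`|w| + `|e| + 1))).
    by rewrite lt_min d0 !divr_gt0.
  move=> u au ub; rewrite lt_min => /andP[ud ue].
  have := dP u _ ud; rewrite /= in_itv /= au ub => /(_ isT) xu.
  have : `|u - t| * (`|w| + `|e| + 1) <= e1 / 2.
    by rewrite -ler_pdivlMr // ltW.
  by have := normr_ge0 (u - t); nra.
have Dle t u : D t u <= `|x u - x t| + `|u - t| * `|w| + `|e| * `|u - t|.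
  rewrite /D lerD //; first by rewrite (le_trans (ler_normB _ _)) // normrZ.
  by rewrite -normrM -normrN ler_norm.
apply: (@increment_le0 D) => //.
- by move=> t; rewrite /D !subrr scale0r subr0 normr0 mulr0 subr0.
- move=> t u v; rewrite /D.
  have -> : x v - x t - (v - t) *: w =
      (x u - x t - (u - t) *: w) + (x v - x u - (v - u) *: w).
    rewrite addrACA [x u - x t + _]addrC subrKA; congr (_ + _).
    by rewrite -opprD -scalerDl; congr (- (_ *: _)); ring.
  have := ler_normD (x u - x t - (u - t) *: w) (x v - x u - (v - u) *: w).
  by lra.
- move=> e1 e10; have [d d0 dP] := close a (lexx _) (ltW ab) _ e10.
  exists d => // t at_ tad tb; apply: le_trans (Dle _ _) _.
  by apply: dP => //; [exact: ltW | rewrite gtr0_norm; lra].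
- move=> t at_ tb e1 e10; have [d d0 dP] := close t (ltW at_) tb _ e10.
  exists d => // u au tdu ut; apply: le_trans (Dle _ _) _.
  rewrite (distrC (x t)) (distrC t).
  by apply: dP; [exact: ltW|lra|rewrite ltr0_norm; lra].
- move=> t at_ tb e1 e10; have [v dv vw] := dx t at_ tb.
  have [d d0 dP] := dv _ e10.
  exists d => // u tu utd ub; rewrite /D.
  have := dP u; rewrite /= in_itv /= ub (le_trans (ltW at_) (ltW tu)) => /(_ isT).
  have ut0 : 0 < u - t by rewrite subr_gt0.
  rewrite gtr0_norm // => {}dP.
  have {}dP := dP (_ : u - t < d).
  have -> : x u - x t - (u - t) *: w =
    (x u - x t - (u - t) *: v) + (u - t) *: (v - w).
    by rewrite scalerBr addrA subrK.
  have := ler_normD (x u - x t - (u - t) *: v) ((u - t) *: (v - w)).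
  rewrite normrZ gtr0_norm // => N; have {}dP := dP ltac:(lra).
  by nra.
Qed.

End IncrementBound.

Section SolutionEstimates.
Context {R : realType} {n : nat}.
Implicit Types (I : set R) (x y : R -> 'rV[R]_n) (t : R).

Lemma closed_norm_le (B : R) : closed [set xi : 'rV[R]_n | `|xi| <= B].
Proof.
have -> : [set xi : 'rV[R]_n | `|xi| <= B] = Num.norm @^-1` [set y | y <= B] by [].
by apply: closed_comp; [move=> ? _; exact: norm_continuous|exact: closed_le].
Qed.

Lemma compact_norm_le (B : R) : compact [set xi : 'rV[R]_n | `|xi| <= B].
Proof.
apply: bounded_closed_compact; last exact: closed_norm_le.
by exists B; split; [exact: num_real|move=> M BM xi /= /le_trans; apply; exact: ltW].
Qed.

Lemma deriv_at_subset (W : normedModType R) I J (x : R -> W) t v : J `<=` I ->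
  deriv_at I x t v -> deriv_at J x t v.
Proof.
move=> JI H e e0; have [d d0 dP] := H e e0.
by exists d => // u /JI; exact: dP.
Qed.

Lemma cont_at_subset (W : normedModType R) I J (x : R -> W) t : J `<=` I ->
  cont_at I x t -> cont_at J x t.
Proof.
move=> JI H e e0; have [d d0 dP] := H e e0.
by exists d => // u /JI; exact: dP.
Qed.

Lemma deriv_at_local (W : normedModType R) I J (x y : R -> W) t v d : 0 < d ->
  (forall u, J u -> `|u - t| < d -> I u /\ y u = x u) -> y t = x t ->
  deriv_at I x t v -> deriv_at J y t v.
Proof.
move=> d0 H ytE dx e e0; have [d' d'0 dP] := dx e e0.
exists (Num.min d d'); first by rewrite lt_min d0.
move=> u Ju; rewrite lt_min => /andP[ud ud'].
by have [Iu ->] := H u Ju ud; rewrite ytE; exact: dP.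
Qed.

Lemma cont_at_local (W : normedModType R) I J (x y : R -> W) t d : 0 < d ->
  (forall u, J u -> `|u - t| < d -> I u /\ y u = x u) -> y t = x t ->
  cont_at I x t -> cont_at J y t.
Proof.
move=> d0 H ytE dx e e0; have [d' d'0 dP] := dx e e0.
exists (Num.min d d'); first by rewrite lt_min d0.
move=> u Ju; rewrite lt_min => /andP[ud ud'].
by have [Iu ->] := H u Ju ud; rewrite ytE; exact: dP.
Qed.

Lemma deriv_at_glue (W : normedModType R) I (x : R -> W) a t b v :
  I `<=` `[a, b] ->
  deriv_at `[a, t] x t v -> deriv_at `[t, b] x t v -> deriv_at I x t v.
Proof.
move=> Iab dl dr e e0.
have [d1 d10 d1P] := dl e e0; have [d2 d20 d2P] := dr e e0.
exists (Num.min d1 d2); first by rewrite lt_min d10.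
move=> u Iu; rewrite lt_min => /andP[u1 u2].
have := Iab u Iu; rewrite /= in_itv /= => /andP[au ub].
have [ut|tu] := leP u t.
  by apply: d1P => //; rewrite /= in_itv /= au.
by apply: d2P => //; rewrite /= in_itv /= ub ltW.
Qed.

Lemma cont_at_glue (W : normedModType R) I (x : R -> W) a t b :
  I `<=` `[a, b] ->
  cont_at `[a, t] x t -> cont_at `[t, b] x t -> cont_at I x t.
Proof.
move=> Iab dl dr e e0.
have [d1 d10 d1P] := dl e e0; have [d2 d20 d2P] := dr e e0.
exists (Num.min d1 d2); first by rewrite lt_min d10.
move=> u Iu; rewrite lt_min => /andP[u1 u2].
have := Iab u Iu; rewrite /= in_itv /= => /andP[au ub].
have [ut|tu] := leP u t.
  by apply: d1P => //; rewrite /= in_itv /= au.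
by apply: d2P => //; rewrite /= in_itv /= ub ltW.
Qed.

Lemma deriv_at_cont (W : normedModType R) I (x : R -> W) t v :
  deriv_at I x t v -> cont_at I x t.
Proof.
move=> dx e e0; have [d d0 dP] := dx 1 ltr01.
have C0 : 0 < 1 + `|v| by rewrite ltr_pwDl.
exists (Num.min d (e / (1 + `|v|))); first by rewrite lt_min d0 divr_gt0.
move=> u Iu; rewrite lt_min => /andP[ud ue].
have {ue} : `|u - t| * (1 + `|v|) <= e by rewrite -ler_pdivlMr // ltW.
have := dP u Iu ud.
have := ler_normD (x u - x t - (u - t) *: v) ((u - t) *: v).
by rewrite subrK normrZ; nra.
Qed.

Lemma deriv_at_increments (W : normedModType R) I (x : R -> W) t v : I t ->
  (forall e, 0 < e -> exists2 d, 0 < d & forall p q, I p -> I q -> p <= q ->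
     p = t \/ q = t -> q - p < d ->
     `|x q - x p - (q - p) *: v| <= e * (q - p)) ->
  deriv_at I x t v.
Proof.
move=> It H e e0; have [d d0 dP] := H e e0; exists d => // u Iu.
have [tu|/ltW ut] := leP t u.
  by rewrite ger0_norm ?subr_ge0 // => utd; apply: dP => //; left.
rewrite (distrC u) ger0_norm ?subr_ge0 // => tud.
have -> : x u - x t - (u - t) *: v = - (x t - x u - (t - u) *: v).
  by rewrite !opprB addrC; congr (_ + _); rewrite -scaleNr opprB.
by rewrite normrN; apply: dP => //; right.
Qed.

(** Since [F] composed with [x] is continuous up to the ends, the mean value inequality on short
    intervals touching [t] extends the differential equation to one-sided derivatives at [a] and
    [b]. *)
Lemma deriv_at_endpoints (F : 'rV[R]_n -> 'rV[R]_n) x a b : continuous F ->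
  (forall t, a <= t -> t <= b -> cont_at `[a, b] x t) ->
  (forall t, a < t -> t < b -> deriv_at `[a, b] x t (F (x t))) ->
  forall t, a <= t -> t <= b -> deriv_at `[a, b] x t (F (x t)).
Proof.
move=> cF cx dx t at_ tb.
apply: deriv_at_increments => [|e e0]; first by rewrite /= in_itv /= at_.
have [d1 d10 d1P] := continuous_cont_at (cF (x t)) e0.
have [d d0 dP] := cx t at_ tb _ d10.
exists d => // p q; rewrite /= !in_itv /= => /andP[ap pb] /andP[aq qb] pq pqt qpd.
have sub : `[p, q] `<=` `[a, b].
  move=> c; rewrite /= !in_itv /= => /andP[pc cq].
  by rewrite (le_trans ap pc) (le_trans cq qb).
apply: mean_value_ineq => //.
  by move=> c pc cq; apply: (cont_at_subset sub); apply: cx; lra.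
move=> c pc cq; exists (F (x c)).
  by apply: (deriv_at_subset sub); apply: dx; lra.
apply: d1P; apply: dP; first by rewrite /= in_itv /=; apply/andP; split; lra.
by rewrite ltr_distl; case: pqt => <-; apply/andP; split; lra.
Qed.

Context {m : nat} (f : 'I_m -> 'rV[R]_n -> 'rV[R]_n).
Implicit Types (s : R -> 'I_m).

Lemma solution_sub_itv I x s a b : solution f I x s -> 0 <= a -> I b ->
  `[a, b] `<=` I.
Proof.
move=> [tI _ _] a0 Ib t; rewrite /= in_itv /= => /andP[at_ tb].
by apply: time_domain_le tI Ib _ tb; apply: le_trans at_.
Qed.

Lemma solution_mean_value I x s a b g e w : solution f I x s ->
  0 <= a -> a <= b -> I b -> (forall u, a <= u -> u < b -> s u = g) ->
  (forall c, a < c -> c < b -> `|f g (x c) - w| <= e) ->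
  `|x b - x a - (b - a) *: w| <= e * (b - a).
Proof.
move=> sol a0 ab Ib sg H; have sub := solution_sub_itv sol a0 Ib.
have /solutionP[tI cx dx] := sol.
apply: mean_value_ineq => //.
  move=> t at_ tb; apply: (cont_at_subset sub); apply: cx.
  by apply: sub; rewrite /= in_itv /= at_.
move=> t at_ tb; exists (f g (x t)); last exact: H.
apply: (deriv_at_subset sub); rewrite -[in f g _](sg t) ?ltW //.
apply: dx; first by apply: sub; rewrite /= in_itv /= !ltW.
apply: (@constant_not_switching _ _ s a b) => // u au ub.
by rewrite !sg // (lt_trans at_).
Qed.

(** Real induction crosses the switches: to the right of each time the signal is constant for a
    while, and continuity of [x] closes the estimate from the left. *)
Lemma solution_lipschitz I x s a b L : solution f I x s ->
  right_continuous_signal s -> 0 <= a -> a <= b -> I b ->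
  (forall t, a <= t -> t <= b -> `|f (s t) (x t)| <= L) ->
  `|x b - x a| <= L * (b - a).
Proof.
move=> sol rs a0 ab Ib H.
have /solutionP[tI cx dx] := sol.
have sub := solution_sub_itv sol a0 Ib.
apply: (real_induction (P := fun t => `|x t - x a| <= L * (t - a)) (a := a) (b := b)) => //.
- by rewrite /= !subrr normr0 mulr0.
- move=> t at_ tb Pt; have t0 : 0 <= t by exact: le_trans at_.
  have [d d0 dP] := right_continuous_signalP rs t0.
  exists d => // u tu utd ub.
  have -> : L * (u - a) = L * (t - a) + L * (u - t) by ring.
  have -> : x u - x a = (x t - x a) + (x u - x t) by rewrite [_ + (_ - _)]addrC addrA subrK.
  apply: le_trans (ler_normD _ _) _; apply: lerD => //.
  rewrite -[X in `|X|]subr0 -[X in _ - X](scaler0 _ (u - t)).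
  apply: (@solution_mean_value I x s t u (s t)) => //.
  + exact: ltW.
  + by apply: sub; rewrite /= in_itv /= ub (le_trans at_ (ltW tu)).
  + by move=> c tc cu; apply: dP => //; lra.
  + by move=> c tc cu; rewrite subr0 -(dP c) ?H //; lra.
- move=> t at_ tb Pt; apply/ler_addgt0Pr => e e0.
  have [|d d0 dP] := cx t _ e e0.
    by apply: sub; rewrite /= in_itv /= tb ltW.
  pose u := Num.max ((a + t) / 2) (t - d / 2).
  have [cu ut tu] : [/\ a < u, u < t & t - d < u].
    rewrite /u !lt_max gt_max; split; first by apply/orP; left; lra.
      by apply/andP; split; lra.
    by apply/orP; right; lra.
  have := Pt u (ltW cu) ut.
  have := dP u; rewrite (distrC u) (distrC (x u)) gtr0_norm ?subr_gt0 // => K.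
  have {}K : `|x t - x u| <= e.
    by apply: K; [apply: sub; rewrite /= in_itv /= !ltW //; lra|lra].
  have := ler_normD (x u - x a) (x t - x u).
  have -> : (x u - x a) + (x t - x u) = x t - x a by rewrite [_ + (_ - _)]addrC addrA subrK.
  have L0 : 0 <= L by apply: le_trans (H a (lexx _) ab).
  by nra.
Qed.

Lemma continuous_bounded_ball (hf : forall g, continuous (f g)) (B : R) :
  exists2 L, 0 < L & forall g xi, `|xi| <= B -> `|f g xi| <= L.
Proof.
have cK : compact [set xi : 'rV[R]_n | `|xi| <= B] by exact: compact_norm_le.
have bd g : exists L, 0 <= L /\ forall xi, `|xi| <= B -> `|f g xi| <= L.
  have /compact_bounded[M [_ MP]] : compact (f g @` [set xi : 'rV[R]_n | `|xi| <= B]).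
    by apply: continuous_compact cK; apply: continuous_subspaceT; exact: hf.
  exists (`|M| + 1); split; first by rewrite addr_ge0.
  move=> xi xiB; apply: MP; last by exists xi.
  by rewrite (le_lt_trans (ler_norm _)) // ltrDl.
have /choice[Lf LfP] := bd.
(* The sum dominates the bound of each of the finitely many modes; adding 1 makes it positive. *)
exists (1 + \sum_g Lf g).
  by rewrite ltr_pwDl // sumr_ge0 // => g _; case: (LfP g).
move=> g xi xiB; apply: le_trans ((LfP g).2 xi xiB) _.
rewrite (bigD1 g) //= addrCA lerDl addr_ge0 // sumr_ge0 // => h _.
by case: (LfP h).
Qed.

End SolutionEstimates.

(** * Limits along ultrafilters and Peano's theorem *)

Section FilterLimits.
Context {R : realType} {n : nat}.
Implicit Types (U : set_system nat).

Lemma cvg_norm_le (T : Type) (U : set_system T) (x : T -> 'rV[R]_n) l C : ProperFilter U ->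
  x @ U --> l -> (\forall k \near U, `|x k| <= C) -> `|l| <= C.
Proof.
move=> FU xl xC.
exact: (closed_cvg (fun z => `|z| <= C) (@closed_norm_le R n C) xC _ xl).
Qed.

(** Compactness yields a cluster point, and for an ultrafilter, which contains each set or its
    complement, a cluster point is a limit. *)
Lemma ultra_bounded_cvg (T : Type) (U : set_system T) (x : T -> 'rV[R]_n) B : UltraFilter U ->
  (\forall k \near U, `|x k| <= B) -> exists l : 'rV[R]_n, x @ U --> l.
Proof.
move=> UU xB; have PU : ProperFilter U by exact: ultra_proper.
have cK : compact [set xi : 'rV[R]_n | `|xi| <= B] by exact: compact_norm_le.
have [l [_ cl]] := cK (x @ U) _ xB.
exists l => A Al; have [//|nA] := in_ultra_setVsetC (x @^-1` A) UU.
by have [p [/= ]] := cl (~` A) A nA Al.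
Qed.

Lemma ultra_bounded_nat (T : Type) (U : set_system T) (N : T -> nat) B : UltraFilter U ->
  (\forall k \near U, (N k <= B)%N) -> exists j, \forall k \near U, N k = j.
Proof.
move=> UU; elim: B => [|B IH] NB.
  by exists 0%N; apply: filterS NB => k; rewrite leqn0 => /eqP.
have [h|h] := in_ultra_setVsetC [set k | (N k <= B)%N] UU; first exact: IH.
exists B.+1; apply: filterS2 NB h => k /= NB /negP.
by rewrite -ltnNge => BN; apply/eqP; rewrite eqn_leq NB.
Qed.

Lemma ultra_ord (T : Type) m (U : set_system T) (s : T -> 'I_m) : UltraFilter U ->
  exists g, \forall k \near U, s k = g.
Proof.
move=> UU; have PU : ProperFilter U by exact: ultra_proper.
have [|j Hj] := @ultra_bounded_nat _ U (fun k => s k : nat) m UU.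
  by apply: nearW => k; exact: ltnW.
have [k sk] := filter_ex Hj.
by exists (s k); apply: filterS Hj => k' /=; rewrite -sk => /val_inj.
Qed.

Lemma free_ultrafilter : exists2 U : set_system nat, UltraFilter U & \oo `<=` U.
Proof. by have [U [UU oU]] := ultraFilterLemma (eventually_filter); exists U. Qed.

(** Shared by Peano's theorem and by limits of trajectories. The equicontinuity estimate keeps
    [F (Y k c)] close to [F (y t)] for all [c] near [t] at once, so the mean value inequality passes
    to the limit. The slack [eta] makes room for approximants that are not continuous. *)
Lemma cvg_filter_deriv U (Y : nat -> R -> 'rV[R]_n) y F (L a b : R) :
  ProperFilter U -> continuous F -> 0 <= L ->
  (forall t, a <= t -> t <= b -> Y ^~ t @ U --> y t) ->
  (forall eta, 0 < eta -> \forall k \near U, forall t u, a <= t -> t <= u -> u <= b ->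
     `|Y k u - Y k t| <= L * (u - t) + eta) ->
  (forall w e eta, 0 < eta -> \forall k \near U,
     forall t u, a <= t -> t <= u -> u <= b ->
     (forall c, t <= c -> c <= u -> `|F (Y k c) - w| <= e) ->
     `|Y k u - Y k t - (u - t) *: w| <= e * (u - t) + eta) ->
  forall t, a <= t -> t <= b -> deriv_at `[a, b] y t (F (y t)).
Proof.
move=> PU cF L0 Yy lip mv t at_ tb.
apply: deriv_at_increments => [|e e0]; first by rewrite /= in_itv /= at_.
have [d1 d10 d1P] := continuous_cont_at (cF (y t)) e0.
(* Three errors of at most [d1 / 4] add up below [d1]: the Lipschitz increment over [[p, q]], its
   slack, and the distance from [Y k t] to [y t]. *)
exists (d1 / 4 / (L + 1)); first by rewrite !divr_gt0 // ltr_wpDl.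
move=> p q; rewrite /= !in_itv /= => /andP[ap pb] /andP[aq qb] pq pqt.
rewrite ltr_pdivlMr; last by rewrite ltr_wpDl.
move=> qpd; apply/ler_addgt0Pr => eta eta0.
have d14 : 0 < d1 / 4 by rewrite divr_gt0.
have lim : (fun k => Y k q - Y k p - (q - p) *: F (y t)) @ U -->
    (y q - y p - (q - p) *: F (y t)).
  by apply: cvgB; [apply: cvgB; exact: Yy|exact: cvg_cst].
apply: cvg_norm_le lim _.
have /cvgrPdist_le/(_ _ d14) near_t := Yy t at_ tb.
apply: filterS3 near_t (lip _ d14) (mv (F (y t)) e eta eta0).
move=> k kt klip kmv; apply: kmv => // c pc cq.
apply: d1P.
have {}kt : `|Y k t - y t| <= d1 / 4 by rewrite distrC.
have : `|Y k c - Y k t| <= L * (q - p) + d1 / 4.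
  case: pqt => tE; subst t.
    by apply: le_trans (klip p c _ _ _) _ => //; [exact: le_trans qb|nra].
  rewrite distrC; apply: le_trans (klip c q _ _ _) _ => //; last nra.
  exact: le_trans ap pc.
have := ler_normD (Y k c - Y k t) (Y k t - y t); rewrite addrA subrK.
by nra.
Qed.

End FilterLimits.

(** * Peano's theorem by Euler's method *)

Section Peano.
Context {R : realType} {n : nat} (F : 'rV[R]_n -> 'rV[R]_n).

Fixpoint euler (h : R) (xi : 'rV[R]_n) (j : nat) : 'rV[R]_n :=
  if j is i.+1 then euler h xi i + h *: F (euler h xi i) else xi.

(** A discrete mean value inequality: each step of the scheme deviates from [h *: w] by at most
    [e * h]. *)
Lemma euler_increment h xi w e i j : 0 <= h -> (i <= j)%N ->
  (forall l, (i <= l)%N -> (l < j)%N -> `|F (euler h xi l) - w| <= e) ->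
  `|euler h xi j - euler h xi i - ((j - i)%:R * h) *: w| <= e * ((j - i)%:R * h).
Proof.
move=> h0; elim: j => [|j IH].
  by rewrite leqn0 => /eqP -> _; rewrite subnn !mul0r scale0r subrr subr0 normr0 mulr0.
rewrite leq_eqVlt => /predU1P[->|ij] H.
  by rewrite subnn !mul0r scale0r subrr subr0 normr0 mulr0.
rewrite ltnS in ij; have {}IH := IH ij (fun l il lj => H l il (ltnW lj)).
rewrite subSn // -natr1 mulrDl mul1r mulrDr /=.
have -> : euler h xi j + h *: F (euler h xi j) - euler h xi i - ((j - i)%:R * h + h) *: w
  = (euler h xi j - euler h xi i - ((j - i)%:R * h) *: w) + h *: (F (euler h xi j) - w).
  rewrite scalerDl scalerBr opprD !addrA; congr (_ - _).
  by rewrite -!addrA; congr (_ + _); rewrite addrC -addrA.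
apply: le_trans (ler_normD _ _) _; apply: lerD => //.
by rewrite normrZ ger0_norm // mulrC ler_wpM2r // H.
Qed.

Lemma peano_existence xi : continuous F ->
  exists2 d, 0 < d & exists2 y : R -> 'rV[R]_n, y 0 = xi &
    forall t, 0 <= t -> t <= d -> deriv_at `[0, d] y t (F (y t)).
Proof.
move=> cF.
have [L L0 LP] := continuous_bounded_ball (m := 1) (fun _ => cF) (`|xi| + 1).
have {}LP z : `|z| <= `|xi| + 1 -> `|F z| <= L by exact: (LP ord0).
pose h (k : nat) : R := k.+1%:R^-1.
have h0 k : 0 < h k by rewrite invr_gt0.
(* The bound [L] on [F] holds only in the ball of radius [|xi| + 1]. By strong induction the earlier
   iterates stay there, and at speed [L] a time [L^-1] covers a distance of at most 1. *)
have bd k j : j%:R * h k <= L^-1 ->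
    forall i, (i <= j)%N -> `|euler (h k) xi i| <= `|xi| + 1 .
  move=> jh; elim/ltn_ind => i IH ij.
  have := @euler_increment (h k) xi 0 L 0 i (ltW (h0 k)) (leq0n i).
  rewrite subn0 scaler0 subr0 => H.
  have {}H : `|euler (h k) xi i - xi| <= L * (i%:R * h k).
    by apply: H => l _ li; rewrite subr0 LP // IH // (leq_trans _ ij) // ltnW.
  have : L * (i%:R * h k) <= 1.
    rewrite mulrC -ler_pdivlMr // div1r; apply: le_trans jh.
    by rewrite ler_wpM2r ?(ltW (h0 k)) // ler_nat.
  by have := ler_normD (euler (h k) xi i - xi) xi; rewrite subrK; lra.
pose d := L^-1.
have d0 : 0 < d by rewrite invr_gt0.
pose idx k t := Num.truncn (t / h k).
pose Y k t := euler (h k) xi (idx k t).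
have idxP k t : 0 <= t -> (idx k t)%:R * h k <= t < (idx k t)%:R * h k + h k.
  move=> t0; have /andP[le lt] := truncn_itv (divr_ge0 t0 (ltW (h0 k))).
  rewrite -ler_pdivlMr ?h0 // le /=.
  by move: lt; rewrite ltr_pdivrMr // -natr1 mulrDl mul1r.
have idx_nat k l : idx k (l%:R * h k) = l by rewrite /idx mulfK ?gt_eqF // natrK.
have idx_le k t u : t <= u -> (idx k t <= idx k u)%N.
  by move=> tu; apply: le_truncn; rewrite ler_pM2r // invr_gt0.
(* [Y k] is a step function: rounding [t] and [u] down to the grid alters the elapsed time by at
   most [h k], whence the error [h k * (e + |w|)], which vanishes along [U]. *)
have Yincr k t u w e : 0 <= t -> t <= u ->
    (forall c, t <= c -> c <= u -> `|F (Y k c) - w| <= e) ->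
    `|Y k u - Y k t - (u - t) *: w| <= e * (u - t) + h k * (e + `|w|).
  move=> t0 tu H; have u0 : 0 <= u by exact: le_trans tu.
  have e0 : 0 <= e by apply: le_trans (H t (lexx _) tu).
  have /andP[t1 t2] := idxP k t t0; have /andP[u1 u2] := idxP k u u0.
  have := @euler_increment (h k) xi w e (idx k t) (idx k u) (ltW (h0 k)) (idx_le k _ _ tu).
  rewrite natrB ?idx_le // => K.
  have /K {K} : forall l, (idx k t <= l)%N -> (l < idx k u)%N ->
      `|F (euler (h k) xi l) - w| <= e.
    move=> l; rewrite leq_eqVlt => /predU1P[<- _|tl lu]; first exact: H.
    have -> : euler (h k) xi l = Y k (l%:R * h k) by rewrite /Y idx_nat.
    apply: H.
      apply: ltW; apply: lt_le_trans t2 _; rewrite -[X in _ + X]mul1r -mulrDl.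
      by rewrite ler_pM2r // natr1 ler_nat.
    apply: le_trans u1; rewrite ler_pM2r // ler_nat; exact: ltnW.
  rewrite -/(Y k u) -/(Y k t); set r := (_ - _) * h k => K.
  have rE : r = (idx k u)%:R * h k - (idx k t)%:R * h k by rewrite /r mulrBl.
  have -> : Y k u - Y k t - (u - t) *: w =
     (Y k u - Y k t - r *: w) + (r - (u - t)) *: w.
    by rewrite [(r - _) *: w]scalerBl addrA subrK.
  apply: le_trans (ler_normD _ _) _; rewrite normrZ.
  have : `|r - (u - t)| <= h k by rewrite rE ler_norml; move: t1 t2 u1 u2; clear; lra.
  move=> rh; have := ler_wpM2r (normr_ge0 w) rh.
  have := ler_wpM2l e0 (le_trans (ler_norm _) rh).
  by move: K; lra.
have [U UU oU] := free_ultrafilter.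
have PU : ProperFilter U by exact: ultra_proper.
have hU c : 0 < c -> \forall k \near U, h k <= c.
  move=> c0; apply: oU; apply: filterS (near_infty_natSinv_lt (PosNum c0)) => k /=.
  exact: ltW.
have Ybd k t : 0 <= t -> t <= d -> `|Y k t| <= `|xi| + 1.
  move=> t0 td; apply: bd (leqnn _).
  by have /andP[it _] := idxP k t t0; apply: le_trans it td.
have lim t : exists z : 'rV[R]_n, 0 <= t -> t <= d -> Y ^~ t @ U --> z.
  have [/andP[t0 td]|nt] := boolP (0 <= t <= d); last first.
    by exists 0 => t0 td; rewrite t0 td in nt.
  have [|z zP] := @ultra_bounded_cvg _ _ _ U (Y ^~ t) (`|xi| + 1) UU.
    by apply: nearW => k; exact: Ybd.
  by exists z.
have [y yP] := choice lim.
exists d => //; exists y.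
  have := yP 0 (lexx _) (ltW d0).
  have -> : Y ^~ 0 = cst xi.
    by apply/funext => k; rewrite /Y /idx mul0r truncn0.
  by move=> yl; apply: (cvg_unique (@norm_hausdorff _ _) yl (cvg_cst xi)).
apply: (@cvg_filter_deriv _ _ U Y y F L) => //; first exact: ltW.
  move=> eta eta0; apply: filterS (hU (eta / L) (divr_gt0 eta0 L0)) => k hk t u t0 tu ud.
  have := Yincr k t u 0 L t0 tu; rewrite scaler0 subr0 normr0 addr0 => K.
  apply: le_trans (K _) _; last by rewrite lerD2l -ler_pdivlMr.
  by move=> c tc cu; rewrite subr0 LP // Ybd //; lra.
move=> w e eta eta0.
have C0 : 0 < `|e| + `|w| + 1 by rewrite ltr_wpDl // addr_ge0.
apply: filterS (hU _ (divr_gt0 eta0 C0)) => k hk t u t0 tu ud H.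
apply: le_trans (Yincr k t u w e t0 tu H) _; rewrite lerD2l.
move: hk; rewrite ler_pdivlMr // => hk; apply: le_trans hk.
by rewrite ler_pM2l // -addrA lerD ?ler_norm // lerDl.
Qed.

End Peano.

(** * Decrease of the Lyapunov function *)

Section EuclideanNorm.
Context {R : realType} {n : nat}.
Implicit Types (xi : 'rV[R]_n).

Lemma enorm_ge0 xi : 0 <= enorm xi.
Proof. exact: sqrtr_ge0. Qed.

Lemma enorm0 : enorm (0 : 'rV[R]_n) = 0.
Proof.
by rewrite /enorm big1 ?sqrtr0 // => i _; rewrite mxE expr0n.
Qed.

Lemma norm_le_enorm xi : `|xi| <= enorm xi.
Proof.
rewrite [leLHS]/Num.Def.normr /= mx_normrE; apply: bigmax_le; first exact: enorm_ge0.
move=> [i j] _ /=; rewrite -sqrtr_sqr; apply: ler_wsqrtr.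
by rewrite ord1 (bigD1 j) //= lerDl sumr_ge0 // => k _; exact: sqr_ge0.
Qed.

Lemma enorm_continuous : continuous (enorm : 'rV[R]_n -> R).
Proof.
move=> xi; rewrite /continuous_at /enorm.
apply: (@continuous_comp _ _ _ (fun v : 'rV[R]_n => \sum_i v 0 i ^+ 2) Num.sqrt);
  last exact: sqrt_continuous.
have sq i : continuous (fun v : 'rV[R]_n => v 0 i ^+ 2).
  move=> v; apply: (@continuous_comp _ _ _ (fun w : 'rV[R]_n => w 0 i) (fun r => r ^+ 2)).
    exact: coord_continuous.
  exact: exprn_continuous.
have : continuous (fun v : 'rV[R]_n => \sum_i v 0 i ^+ 2); last exact.
by apply: continuous_big => //; exact: add_continuous.
Qed.

End EuclideanNorm.

Section CompositionAlongCurve.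
Context {R : realType} {n : nat}.
Implicit Types (W : 'rV[R]_n -> R) (p q : 'rV[R]_n).

Lemma cont_at_comp W I (x : R -> 'rV[R]_n) t :
  {for x t, continuous W} -> cont_at I x t -> cont_at I (W \o x) t.
Proof.
move=> cW cx e e0.
have /cvgrPdist_le/(_ _ e0)/nbhs_ballP[d /= d0 dP] := cW.
have [|d' d'0 d'P] := cx (d / 2); first by rewrite divr_gt0.
exists d' => // u Iu utd'; rewrite distrC; apply: dP.
rewrite -ball_normE /= distrC; apply: le_lt_trans (d'P u Iu utd') _.
by rewrite ltr_pdivrMr // ltr_pMr // ltr1n.
Qed.

Lemma differential_expansion W p : differentiable W p ->
  forall e, 0 < e -> exists2 d, 0 < d &
    forall q, `|q - p| <= d -> `|W q - W p - 'd W p (q - p)| <= e * `|q - p|.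
Proof.
move=> dW e e0; have /eqaddoP/(_ e e0)/nbhs_ballP[d /= d0 dP] := diff_locally dW.
exists (d / 2); first by rewrite divr_gt0.
move=> q qp; have := dP (q - p).
rewrite -ball_normE /= sub0r normrN => /(_ _).
rewrite !fctE /= subrK opprD addrA; apply.
by apply: le_lt_trans qp _; rewrite ltr_pdivrMr // ltr_pMr // ltr1n.
Qed.

Lemma differential_bounded W p : differentiable W p ->
  exists2 M, 0 < M & forall v, `|'d W p v| <= M * `|v|.
Proof.
move=> dW; have /(_ 0) c0 := diff_continuous dW.
have := c0 : {for 0, continuous ('d W p)}.
move=> /cvgrPdist_le/(_ _ ltr01)/nbhs_ballP[d /= d0 dP].
exists (2 / d); first by rewrite divr_gt0.
move=> v; have [->|v0] := eqVneq v 0.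
  by rewrite linear0 !normr0 mulr0.
have nv : 0 < `|v| by rewrite normr_gt0.
(* Rescaling [v] to length [d / 2] brings it into the ball where the differential is at most 1. *)
pose c := d / 2 / `|v|.
have c_gt0 : 0 < c by rewrite !divr_gt0.
have := dP (c *: v); rewrite -ball_normE /= sub0r normrN normrZ gtr0_norm //.
have -> : c * `|v| = d / 2 by rewrite /c divfK // gt_eqF.
move=> /(_ _); rewrite linear0 sub0r normrN linearZ /= normrM gtr0_norm //.
move=> H; have {}H := H ltac:(by rewrite ltr_pdivrMr // ltr_pMr // ltr1n).
rewrite -(ler_pM2l c_gt0); apply: le_trans H _.
by rewrite /c le_eqVlt; apply/orP; left; apply/eqP; field; rewrite !gt_eqF.
Qed.

End CompositionAlongCurve.

Section LyapunovDecrease.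
Context {R : realType} {n m : nat} (f : 'I_m -> 'rV[R]_n -> 'rV[R]_n).
Context (chi : 'I_m -> set 'rV[R]_n) (V : 'I_m -> 'rV[R]_n -> R).
Hypothesis dV : forall g xi, differentiable (V g) xi.
Hypothesis Vdec : forall xi g, chi g xi -> 'd (V g) xi (f g xi) <= 0.

(** The chain rule bounds the right slope of [V g] along [x] by 0 up to an arbitrary error. The mode
    is prescribed on [[a, b[] only, so the inequality, which keeps [V g] at [b], remains available
    when a switch occurs at [b]. *)
Lemma lyapunov_nonincreasing I x (s : R -> 'I_m) a b g : solution f I x s ->
  (forall t, I t -> chi (s t) (x t)) ->
  0 <= a -> a <= b -> I b -> (forall u, a <= u -> u < b -> s u = g) ->
  V g (x b) <= V g (x a).
Proof.
move=> sol cov a0; rewrite le_eqVlt => /predU1P[->//|ab] Ib sg.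
have sub := solution_sub_itv sol a0 Ib.
have /solutionP[tI cx dx] := sol.
have sub' t : a <= t -> t <= b -> I t.
  by move=> ? ?; apply: sub; rewrite /= in_itv /=; apply/andP.
rewrite -subr_le0.
have cVx t : a <= t -> t <= b -> cont_at I (V g \o x) t.
  move=> at_ tb; apply: cont_at_comp; last by apply: cx; exact: sub'.
  exact: differentiable_continuous.
apply: (@increment_le0 _ (fun t u => V g (x u) - V g (x t)) a b) => //.
- by move=> t; rewrite subrr.
- by move=> t u v; lra.
- move=> e e0; have [d d0 dP] := cVx a (lexx _) (ltW ab) e e0.
  exists d => // t at_ tad tb; apply: le_trans (ler_norm _) _.
  apply: dP; first by apply: sub' => //; exact: ltW.
  by rewrite gtr0_norm; lra.
- move=> t at_ tb e e0; have [d d0 dP] := cVx t (ltW at_) tb e e0.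
  exists d => // u au tdu ut; apply: le_trans (ler_norm _) _.
  rewrite distrC; apply: dP; first by apply: sub'; [exact: ltW|lra].
  by rewrite ltr0_norm; lra.
- move=> t at_ tb e e0.
  have It : I t by apply: sub'; exact: ltW.
  have stg : s t = g by apply: sg => //; exact: ltW.
  have ns : ~ switching_time s t.
    apply: (@constant_not_switching _ _ s a b) => // u au ub.
    by rewrite !sg.
  have := dx t It ns; rewrite stg => dxt.
  have := Vdec (cov t It); rewrite stg => Vle.
  have [M M0 MP] := differential_bounded (dV g (x t)).
  set v := f g (x t) in dxt Vle.
  have C0 : 0 < `|v| + 1 by rewrite ltr_wpDl.
  (* Half of [e] pays for the expansion of [V g], since [x] moves by at most [(|v| + 1) * (u - t)];
     the other half pays for the differential, of norm at most [M], on the remainder of [x]. *)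
  have [d1 d10 d1P] := differential_expansion (dV g (x t)) (divr_gt0 (divr_gt0 e0 (ltr0n _ 2)) C0).
  have [d2 d20 d2P] := cx t It _ d10.
  have [d3 d30 d3P] := dxt _ (divr_gt0 (divr_gt0 e0 (ltr0n _ 2)) M0).
  have [d4 d40 d4P] := dxt _ (@ltr01 R).
  exists (Num.min d2 (Num.min d3 d4)); first by rewrite !lt_min d20 d30 d40.
  move=> u tu utd ub.
  have Iu : I u by apply: sub' => //; apply: le_trans (ltW at_) (ltW tu).
  have ut0 : 0 < u - t by rewrite subr_gt0.
  have uE : `|u - t| = u - t by rewrite gtr0_norm.
  have : u - t < Num.min d2 (Num.min d3 d4) by lra.
  rewrite !lt_min => /and3P[ut2 ut3 ut4].
  have {}d2P := d1P _ (d2P u Iu ltac:(by rewrite uE)).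
  have {}d3P := d3P u Iu ltac:(by rewrite uE).
  have {}d4P := d4P u Iu ltac:(by rewrite uE).
  rewrite uE mul1r in d4P; rewrite uE in d3P.
  have xle : `|x u - x t| <= (`|v| + 1) * (u - t).
    have := ler_normD (x u - x t - (u - t) *: v) ((u - t) *: v).
    by rewrite subrK normrZ uE; lra.
  have {}d2P : `|V g (x u) - V g (x t) - 'd (V g) (x t) (x u - x t)| <= e / 2 * (u - t).
    apply: le_trans d2P _.
    apply: (@le_trans _ _ (e / 2 / (`|v| + 1) * ((`|v| + 1) * (u - t)))).
      by rewrite ler_pM2l // !divr_gt0.
    by rewrite mulrA divfK // gt_eqF.
  have dE : 'd (V g) (x t) (x u - x t) =
    (u - t) * 'd (V g) (x t) v + 'd (V g) (x t) (x u - x t - (u - t) *: v).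
    set r := x u - x t - (u - t) *: v.
    have -> : x u - x t = (u - t) *: v + r by rewrite [RHS]addrC /r subrK.
    by rewrite linearD; congr (_ + _); exact: linearZ.
  have := MP (x u - x t - (u - t) *: v) => K.
  have {}K : `|'d (V g) (x t) (x u - x t - (u - t) *: v)| <= e / 2 * (u - t).
    apply: le_trans K _; rewrite -ler_pdivlMl //; apply: le_trans d3P _.
    by rewrite le_eqVlt; apply/orP; left; apply/eqP; field; rewrite gt_eqF.
  have := ler_norm ('d (V g) (x t) (x u - x t - (u - t) *: v)).
  have := ler_norm (V g (x u) - V g (x t) - 'd (V g) (x t) (x u - x t)).
  have : (u - t) * 'd (V g) (x t) v <= 0 by rewrite pmulr_rle0.
  by move: d2P K; rewrite dE; lra.
Qed.

End LyapunovDecrease.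

(** * Continuation of solutions *)

Section Completeness.
Context {R : realType} {n m : nat} (f : 'I_m -> 'rV[R]_n -> 'rV[R]_n).
Hypothesis cf : forall g, continuous (f g).
Implicit Types (x : R -> 'rV[R]_n) (s : R -> 'I_m).

(** A bounded solution has bounded speed, so it is Lipschitz and has a limit at [T]. *)
Lemma solution_extends_closed x s T B : 0 < T -> right_continuous_signal s ->
  solution f `[0, T[ x s -> (forall t, 0 <= t -> t < T -> `|x t| <= B) ->
  exists2 y, solution f `[0, T] y s & forall t, `[0, T[%classic t -> y t = x t.
Proof.
move=> T0 rs sol xB.
have [L L0 LP] := continuous_bounded_ball cf B.
have lip a b : 0 <= a -> a <= b -> b < T -> `|x b - x a| <= L * (b - a).
  move=> a0 ab bT; apply: (solution_lipschitz sol rs a0 ab).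
    by rewrite /= in_itv /= bT (le_trans a0 ab).
  by move=> t at_ tb; apply/LP/xB; lra.
have [U UU oU] := free_ultrafilter.
have PU : ProperFilter U by exact: ultra_proper.
(* A sequence increasing to [T] suffices to find the end value: by the Lipschitz bound its limit
   along [U] is the full left limit. *)
pose tk (k : nat) : R := T - T * k.+1%:R^-1.
have tkP k : 0 <= tk k /\ tk k < T.
  rewrite /tk subr_ge0 ltrBlDr ltrDl mulr_gt0 ?invr_gt0 //; split=> //.
  by rewrite -[leRHS]mulr1 ler_pM2l // invf_le1 // ler1n.
have [l xl] := @ultra_bounded_cvg _ _ _ U (x \o tk) B UU
   ltac:(by apply: nearW => k; have [? ?] := tkP k; exact: xB).
have lipT a : 0 <= a -> a < T -> `|l - x a| <= L * (T - a).
  move=> a0 aT.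
  have lim : (fun k => x (tk k) - x a) @ U --> l - x a.
    by apply: cvgB => //; exact: cvg_cst.
  apply: (cvg_norm_le PU lim).
  have c0 : 0 < (T - a) / T by rewrite divr_gt0 // subr_gt0.
  apply: oU; apply: filterS (near_infty_natSinv_lt (PosNum c0)) => k /=.
  rewrite ltr_pdivlMr // mulrC => ka; have [tk0 tkT] := tkP k.
  have atk : a <= tk k by rewrite /tk lerBrDr -lerBrDl ltW.
  by apply: le_trans (lip a _ a0 atk tkT) _; rewrite ler_pM2l //; lra.
pose y t := if t < T then x t else l.
have yx t : t < T -> y t = x t by move=> tT; rewrite /y tT.
have yT : y T = l by rewrite /y ltxx.
exists y; last by move=> t; rewrite /= in_itv /= => /andP[_ /yx ->].
have /solutionP[_ cx dx] := sol.
have cy t : 0 <= t -> t <= T -> cont_at `[0, T] y t.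
  move=> t0; rewrite le_eqVlt => /predU1P[->|tT].
    move=> e e0; exists (e / L); first by rewrite divr_gt0.
    move=> u; rewrite /= in_itv /= => /andP[u0]; rewrite le_eqVlt => /predU1P[->|uT].
      by rewrite (subrr (y T)) normr0 => _; exact: ltW.
    rewrite ltr_pdivlMr // distrC gtr0_norm ?subr_gt0 // => uTe.
    by rewrite yT yx // distrC; apply: le_trans (lipT u u0 uT) _; rewrite mulrC ltW.
  apply: (@cont_at_local _ _ `[0, T[ _ x y t (T - t)); rewrite ?subr_gt0 ?yx //.
    move=> u; rewrite /= !in_itv /= => /andP[u0 uT] utT.
    have uT' : u < T by move: utT; rewrite ltr_distl; lra.
    by rewrite u0 uT' yx.
  by apply: cx; rewrite /= in_itv /= t0.
apply/solutionP; split.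
- by apply: Or32; exists T.
- by move=> t; rewrite /= in_itv /= => /andP[t0 tT]; exact: cy.
- move=> t; rewrite /= in_itv /= => /andP[t0]; rewrite le_eqVlt => /predU1P[->|tT].
    move=> /(not_switching_timeP _ T0)[d d0 dP].
    (* The signal equals [s T] on [[a, T]], so a single continuous field governs the solution there
       and the equation reaches [T]. *)
    pose a := Num.max 0 (T - d / 2).
    have [a0 aT Tda] : [/\ 0 <= a, a < T & T - d < a].
      rewrite /a le_max lexx gt_max T0 lt_max /=; split=> //; first by lra.
      by apply/orP; right; lra.
    have sub : `[a, T] `<=` `[0, T].
      by move=> u; rewrite /= !in_itv /= => /andP[au ->]; rewrite (le_trans a0 au).
    have dT : deriv_at `[a, T] y T (f (s T) (y T)).
      apply: (deriv_at_endpoints (@cf (s T))); [|move=> u au uT|exact: ltW|exact: lexx].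
        move=> u au uT; apply: (cont_at_subset sub); apply: cy => //.
        exact: le_trans au.
      have su : s u = s T by apply: dP; rewrite ltr_distl; apply/andP; split; lra.
      apply: (deriv_at_subset sub); rewrite -su.
      have u0 : 0 < u by exact: le_lt_trans au.
      apply: (@deriv_at_local _ _ `[0, T[ _ x y u _ (T - u)); rewrite ?subr_gt0 ?yx //.
        move=> v; rewrite /= !in_itv /= => /andP[v0 vT] vuT.
        have vT' : v < T by move: vuT; rewrite ltr_distl; lra.
        by rewrite v0 vT' yx.
      apply: dx; first by rewrite /= in_itv /= uT ltW.
      apply: (@constant_not_switching _ _ s a T) => // v av vT.
      by rewrite !dP // ltr_distl; apply/andP; split; lra.
    apply: (@deriv_at_local _ _ `[a, T] _ y y T _ (T - a)); rewrite ?subr_gt0 //.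
    move=> u; rewrite /= !in_itv /= => /andP[u0 ->].
    by rewrite ltr_distl => ua; split=> //; lra.
  move=> ns; apply: (@deriv_at_local _ _ `[0, T[ _ x y t _ (T - t)); rewrite ?subr_gt0 ?yx //.
    move=> u; rewrite /= !in_itv /= => /andP[u0 uT] utT.
    have uT' : u < T by move: utT; rewrite ltr_distl; lra.
    by rewrite u0 uT' yx.
  by apply: dx => //; rewrite /= in_itv /= t0.
Qed.

(** Right-continuity freezes the mode [s T] for a while, during which a Peano solution starting at
    [x T] continues [x]. At [T] the two one-sided derivatives are glued if it is no switching time;
    otherwise no derivative is required there. *)
Lemma solution_extends_past x s T : 0 < T -> right_continuous_signal s ->
  solution f `[0, T] x s ->
  exists2 T', T < T' & exists2 y, solution f `[0, T'] y s &
    forall t, `[0, T]%classic t -> y t = x t.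
Proof.
move=> T0 rs sol.
have /solutionP[_ cx dx] := sol.
have [d1 d10 [z z0 dz]] := peano_existence (x T) (@cf (s T)).
have [d2 d20 d2P] := right_continuous_signalP rs (ltW T0).
pose d := Num.min d1 (d2 / 2).
have [d0 dd1 dd2] : [/\ 0 < d, d <= d1 & d < d2].
  rewrite /d lt_min d10 ge_min lexx gt_min; split=> //=; first lra.
  by apply/orP; right; lra.
exists (T + d); first by rewrite ltrDl.
pose y t := if t <= T then x t else z (t - T).
have yx t : t <= T -> y t = x t by move=> tT; rewrite /y tT.
have yz t : T <= t -> y t = z (t - T).
  rewrite le_eqVlt => /predU1P[<-|Tt]; first by rewrite yx // subrr z0.
  by rewrite /y leNgt Tt.
exists y; last by move=> t; rewrite /= in_itv /= => /andP[_ /yx ->].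
have dy t : T <= t -> t <= T + d -> deriv_at `[T, T + d] y t (f (s T) (y t)).
  move=> Tt tTd; rewrite yz // => e e0.
  have [|| d' d'0 d'P] := dz (t - T) _ _ e e0; [lra|lra|].
  exists d' => // u; rewrite /= in_itv /= => /andP[Tu uTd] ut.
  rewrite !yz //; have := d'P (u - T).
  have -> : u - T - (t - T) = u - t by ring.
  by apply=> //; rewrite /= in_itv /=; apply/andP; split; lra.
have loc t u : t < T -> `[0, T + d]%classic u -> `|u - t| < T - t ->
    `[0, T]%classic u /\ y u = x u.
  move=> tT; rewrite /= !in_itv /= => /andP[u0 uT]; rewrite ltr_distl => utT.
  by split; [rewrite u0 /=|rewrite yx //]; lra.
have locr t u : T < t -> `[0, T + d]%classic u -> `|u - t| < t - T ->
    `[T, T + d]%classic u /\ y u = y u.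
  move=> tT; rewrite /= !in_itv /= => /andP[u0 ->]; rewrite ltr_distl => utT.
  by split=> //; lra.
have dxT v : deriv_at `[0, T] x T v -> deriv_at `[0, T] y T v.
  apply: (@deriv_at_local _ _ _ _ _ _ _ _ 1) => //; last by rewrite yx.
  by move=> u Iu _; rewrite yx //; move: Iu; rewrite /= in_itv /= => /andP[].
have cxT : cont_at `[0, T] y T.
  have /cx : `[0, T]%classic T by rewrite /= in_itv /= lexx ltW.
  apply: (@cont_at_local _ _ _ _ _ _ _ 1) => //; last by rewrite yx.
  by move=> u Iu _; rewrite yx //; move: Iu; rewrite /= in_itv /= => /andP[].
have TTd : T <= T + d by rewrite lerDl ltW.
apply/solutionP; split.
- by apply: Or32; exists (T + d) => //; lra.
- move=> t; rewrite /= in_itv /= => /andP[t0 tTd].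
  have [tT|Tt|->] := ltgtP t T.
  + have yt : y t = x t by rewrite yx // ltW.
    apply: (cont_at_local (d := T - t) _ (fun u => loc t u tT)) => //.
      by rewrite subr_gt0.
    by apply: cx; rewrite /= in_itv /= t0 ltW.
  + apply: (cont_at_local (d := t - T) _ (fun u => locr t u Tt)); rewrite ?subr_gt0 //.
    exact: deriv_at_cont (dy t (ltW Tt) tTd).
  + apply: (cont_at_glue (a := 0) (b := T + d)) => //.
    exact: deriv_at_cont (dy T (lexx _) TTd).
- move=> t; rewrite /= in_itv /= => /andP[t0 tTd] ns.
  have [tT|Tt|tT] := ltgtP t T.
  + have yt : y t = x t by rewrite yx // ltW.
    apply: (deriv_at_local (d := T - t) _ (fun u => loc t u tT)) => //.
      by rewrite subr_gt0.
    by rewrite yt; apply: dx => //; rewrite /= in_itv /= t0 ltW.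
  + apply: (deriv_at_local (d := t - T) _ (fun u => locr t u Tt)); rewrite ?subr_gt0 //.
    by rewrite d2P; [apply: dy; lra|exact: ltW|lra].
  + subst t; apply: (deriv_at_glue (a := 0) (b := T + d)) => //; last exact: dy.
    apply: dxT; rewrite yx //; apply: dx => //.
    by rewrite /= in_itv /= t0 lexx.
Qed.

Lemma bounded_maximal_global p B : maximal_trajectories f p ->
  (forall t, dom p t -> `|state p t| <= B) -> dom p = `[0, +oo[%classic.
Proof.
move=> [[_ rs] [sol max]] bd; have [tI _ _] := sol.
case: tI => [[T T0 IE]|[T T0 IE]|//]; rewrite IE in sol max bd *.
  have [|y soly yx] := solution_extends_closed T0 rs sol (B := B).
    by move=> t t0 tT; apply: bd; rewrite /= in_itv /= t0.
  have := max _ y soly _ yx.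
  have sub : `[0, T[ `<=` `[0, T].
    by move=> t; rewrite /= !in_itv /= => /andP[-> /ltW].
  move=> /(_ sub) E; have : `[0, T]%classic T by rewrite /= in_itv /= lexx ltW.
  by rewrite E /= in_itv /= ltxx andbF.
have [T' TT' [y soly yx]] := solution_extends_past T0 rs sol.
have := max _ y soly _ yx.
have sub : `[0, T] `<=` `[0, T'].
  by move=> t; rewrite /= !in_itv /= => /andP[->] /= /le_trans; apply; exact: ltW.
move=> /(_ sub) E; have : `[0, T']%classic T' by rewrite /= in_itv /= lexx; lra.
by rewrite E /= in_itv /= (leNgt T') TT' andbF.
Qed.

Lemma global_solution_maximal x s : solution f `[0, +oo[ x s ->
  maximal_solution f `[0, +oo[ x s.
Proof.
move=> sol; split=> // J y [tJ _ _] sub _; apply/seteqP; split=> // t Jt.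
by rewrite /= in_itv /= andbT; apply: time_domain_ge0 Jt.
Qed.

End Completeness.

(** * Uniform stability *)

Section Monotonicity.
Context {R : realType} {n m : nat} (f : 'I_m -> 'rV[R]_n -> 'rV[R]_n).

(** The switching condition compares the end of one active period with the start of a later one. The
    decrease within periods supplies the ends of the chain: [V] at [t'], at the last switch [tj]
    before it, at the first switch [c] after [t], and at [t]. *)
Lemma weak_lyapunov_like_monotone TT chi V : TT `<=` covered_trajectories f chi ->
  weak_lyapunov_like f TT chi V -> TT `<=` monotone_trajectories f setT V.
Proof.
move=> cov [C1V _ Vdec Vsw] p TTp; have [pmax pchi] := cov p TTp.
split=> // t t' It It' tt' stt'.
have [[_ rs] [sol _]] := pmax; have [tI _ _] := sol.
have t0 := time_domain_ge0 tI It; have t'0 := time_domain_ge0 tI It'.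
have dV g xi : differentiable (V g) xi by have [] := C1V g.
have dec := lyapunov_nonincreasing dV Vdec sol pchi.
have [ti [sti tit nti]] := last_switching_time rs t0.
have [tj [stj tjt' ntj]] := last_switching_time rs t'0.
have ti0 := switching_time_ge0 sti; have tj0 := switching_time_ge0 stj.
(* If [tj <= t], no switch separates [t] from [t'] and the decrease within one period is enough. *)
have [tjt|ttj] := leP tj t.
  rewrite stt'; apply: dec => // u tu ut'.
  rewrite -stt'; apply: (@constant_between_switching _ _ _ t u) => //.
  by move=> v tv vu; apply: ntj; lra.
have [c [sc tc ctj nc]] := next_switching_time_after rs t0 ttj stj.
have Itj : dom p tj by exact: time_domain_le tI It' tj0 tjt'.
have Ic : dom p c by apply: time_domain_le tI Itj _ ctj; lra.
have stti : signal p t = signal p ti.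
  exact: (@constant_between_switching _ _ _ ti t).
have st'tj : signal p t' = signal p tj.
  exact: (@constant_between_switching _ _ _ tj t').
have nxt : next_switching_time (signal p) ti c.
  split=> //; first exact: le_lt_trans tc.
  move=> u tiu uc; have [ut|tu] := leP u t; first exact: nti.
  exact: nc.
have := Vsw p TTp ti c tj nxt stj (le_lt_trans tit ttj) Itj.
rewrite -st'tj -stti stt' => /(_ erefl) V1.
have V2 : V (signal p t') (state p c) <= V (signal p t') (state p t).
  apply: dec => //; first exact: ltW.
  move=> u tu uc; rewrite -stt'.
  apply: (@constant_between_switching _ _ _ t u) => // v tv vu.
  by apply: nc; lra.
have V3 : V (signal p t') (state p t') <= V (signal p t') (state p tj).
  apply: dec => // u tju ut'; rewrite st'tj.
  apply: (@constant_between_switching _ _ _ tj u) => // v tjv vu.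
  by apply: ntj; lra.
exact: le_trans V3 (le_trans V1 V2).
Qed.

End Monotonicity.

Section ModeCounting.
Context {R : realType} {m : nat}.

(* Induction on the set of modes still allowed: cutting at the first visit of
   the final mode removes that mode and costs one [phi]. *)
Lemma bound_by_modes (phi h : R -> R) (s : R -> 'I_m) I : time_domain I ->
  right_continuous_signal s ->
  (forall t, I t -> cont_at I h t) ->
  (forall t, I t -> 0 <= h t) ->
  (forall r u, 0 <= r -> r <= u -> phi r <= phi u) ->
  (forall r, 0 <= r -> r <= phi r) ->
  (forall t t', I t -> I t' -> t <= t' -> s t = s t' -> h t' <= phi (h t)) ->
  forall t0 t, 0 <= t0 -> t0 <= t -> I t -> h t <= iter m phi (h t0).
Proof.
move=> tI rs ch h0 phile phige mono.
have iter_ge k r : 0 <= r -> r <= iter k phi r.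
  move=> r0; elim: k => //= k IH; apply: le_trans (IH) _; apply: phige.
  exact: le_trans IH.
suff main k (A : {set 'I_m}) t0 t : (#|A| <= k)%N -> 0 <= t0 -> t0 <= t -> I t ->
    (forall u, t0 <= u -> u <= t -> s u \in A) -> h t <= iter k phi (h t0).
  move=> t0 t t00 t0t It; apply: (main m [set: 'I_m]%SET) => //.
    by rewrite cardsT card_ord.
  by move=> u _ _; rewrite finset.in_setT.
elim: k A t0 t => [|k IH] A t0 t cA t00 t0t It sA.
  have := sA t t0t (lexx _); move: cA; rewrite leqn0 cards_eq0 => /eqP ->.
  by rewrite inE.
have It0 : I t0 by exact: time_domain_le tI It t00 t0t.
have ht0 := h0 _ It0.
pose E := [set u | t0 <= u <= t /\ s u = s t].
have Et : E t by rewrite /E /= t0t lexx.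
have Elb : has_inf E by split; [exists t | exists t0 => w [/andP[]]].
have infE w : E w -> inf E <= w by move=> Ew; apply: ge_inf => //; case: Elb.
have inf0 : t0 <= inf E by apply: lb_le_inf; [exists t | move=> w [/andP[]]].
have inft : inf E <= t by exact: infE.
have i0 : 0 <= inf E by exact: le_trans inf0.
have Ii : I (inf E) by exact: time_domain_le tI It i0 inft.
have sinf : s (inf E) = s t.
  have [d d0 dP] := right_continuous_signalP rs i0.
  have [w Ew wd] := inf_adherent d0 Elb.
  by case: (Ew) => _ <-; rewrite (dP w) // infE.
have step : h t <= phi (h (inf E)) by exact: mono.
apply: le_trans step _ => /=; apply: phile; first exact: h0.
have [->|] := eqVneq (inf E) t0; first exact: iter_ge.
rewrite eq_sym => it0.
have {}it0 : t0 < inf E by rewrite lt_neqAle it0.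
(* Before its first visit at [inf E] the final mode does not occur, so the induction hypothesis with
   that mode removed applies up to [u], just earlier; continuity of [h] bridges the gap. *)
apply/ler_addgt0Pr => e e0; have [d d0 dP] := ch _ Ii e e0.
pose u := Num.max ((t0 + inf E) / 2) (inf E - d / 2).
have [tu ui du] : [/\ t0 < u, u < inf E & inf E - d < u].
  rewrite /u !lt_max gt_max; split; first by apply/orP; left; lra.
    by apply/andP; split; lra.
  by apply/orP; right; lra.
have u0 : 0 <= u by exact: le_trans (ltW tu).
have Iu : I u by exact: time_domain_le tI Ii u0 (ltW ui).
have hu : h u <= iter k phi (h t0).
  apply: (IH (A :\ s t)%SET) => //; last first.
  - move=> v tv vu; rewrite in_setD1 sA //; last first.
      by apply: le_trans vu (le_trans (ltW ui) inft).
    rewrite andbT; apply/eqP => svt.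
    suff /infE : E v by rewrite leNgt (le_lt_trans vu ui).
    by rewrite /E /= tv (le_trans vu (le_trans (ltW ui) inft)).
  - exact: ltW.
  - by move: cA; rewrite (cardsD1 (s t)) sA // add1n.
have := dP u Iu; rewrite distrC (distrC (h u)) gtr0_norm ?subr_gt0 // => /(_ _).
have := ler_norm (h (inf E) - h u).
by move=> ? K; have := K ltac:(lra); lra.
Qed.

End ModeCounting.

(** * Calculus of comparison functions *)

Section ClassK.
Context {R : realType}.
Implicit Types (a : R -> R).

Lemma class_Kinf_ge0 a r : class_Kinf a -> 0 <= r -> 0 <= a r.
Proof.
move=> [[_ ainc a0] _]; rewrite le_eqVlt => /predU1P[<-|r0]; first by rewrite a0.
by rewrite -a0 ltW // ainc.
Qed.

Lemma class_Kinf_le a r s : class_Kinf a -> 0 <= r -> r <= s -> a r <= a s.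
Proof.
move=> [[_ ainc _] _] r0; rewrite le_eqVlt => /predU1P[->//|rs].
by rewrite ltW // ainc.
Qed.

Lemma class_KinfP a : class_Kinf a <->
  [/\ forall t, 0 <= t -> cont_at `[0, +oo[ a t,
      forall r s, 0 <= r -> r < s -> a r < a s, a 0 = 0
    & forall B, exists2 r, 0 <= r & B < a r].
Proof.
split=> [[[/within_continuousP ca ai a0] au]|[ca ai a0 au]]; split=> //.
  by move=> t t0; apply: ca; rewrite /= in_itv /= andbT.
split=> //; apply/within_continuousP => t; rewrite /= in_itv /= andbT.
exact: ca.
Qed.

Lemma class_Kinf_comp a b : class_Kinf a -> class_Kinf b -> class_Kinf (a \o b).
Proof.
move=> Ka Kb; have /class_KinfP[ca ai a0 au] := Ka.
have /class_KinfP[cb bi b0 bu] := Kb.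
apply/class_KinfP; split=> /=.
- move=> t t0 e e0.
  have bt0 := class_Kinf_ge0 Kb t0.
  have [d d0 dP] := ca (b t) bt0 e e0.
  have [|d' d'0 d'P] := cb t t0 (d / 2); first by rewrite divr_gt0.
  exists d' => // u Iu utd; apply: dP.
    rewrite /= in_itv /= andbT; apply: class_Kinf_ge0 => //.
    by move: Iu; rewrite /= in_itv /= andbT.
  by apply: le_lt_trans (d'P u Iu utd) _; lra.
- by move=> r s r0 rs; apply: ai; [exact: class_Kinf_ge0|exact: bi].
- by rewrite b0.
- move=> B; have [r r0 Br] := au B; have [s s0 rs] := bu r.
  by exists s => //; apply: lt_trans Br _; apply: ai.
Qed.

Lemma class_Kinf_id : class_Kinf (@id R).
Proof.
apply/class_KinfP; split=> //.
- by move=> t t0 e e0; exists e => // u _ /ltW.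
- by move=> B; exists (`|B| + 1); rewrite ?addr_ge0 // (le_lt_trans (ler_norm B)) // ltrDl.
Qed.

Lemma class_Kinf_add a b : class_Kinf a -> class_Kinf b ->
  class_Kinf (fun r => a r + b r).
Proof.
move=> Ka Kb; have /class_KinfP[ca ai a0 au] := Ka.
have /class_KinfP[cb bi b0 bu] := Kb.
apply/class_KinfP; split=> /=.
- move=> t t0 e e0; have e2 : 0 < e / 2 by rewrite divr_gt0.
  have [d d0 dP] := ca t t0 _ e2; have [d' d'0 d'P] := cb t t0 _ e2.
  exists (Num.min d d'); first by rewrite lt_min d0.
  move=> u Iu; rewrite lt_min => /andP[/(dP _ Iu) h1 /(d'P _ Iu) h2].
  rewrite opprD addrACA; apply: le_trans (ler_normD _ _) _; lra.
- by move=> r s r0 rs; rewrite ltrD // ?ai ?bi.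
- by rewrite a0 b0 addr0.
- move=> B; have [r r0 Br] := au B.
  by exists r => //; have := class_Kinf_ge0 Kb r0; lra.
Qed.

Lemma class_Kinf_iter k a : class_Kinf a -> class_Kinf (iter k a).
Proof.
move=> Ka; elim: k => [|k IH]; first exact: class_Kinf_id.
exact: (class_Kinf_comp Ka IH).
Qed.

Lemma class_Kinf_inv a : class_Kinf a -> exists2 b, class_Kinf b &
  forall r s, 0 <= r -> 0 <= s -> a r <= s -> r <= b s.
Proof.
move=> Ka; have /class_KinfP[ca ai a0 au] := Ka.
have surj s : 0 <= s -> exists r, 0 <= r /\ a r = s.
  move=> s0; have [r r0 sr] := au s.
  have [||c] := @IVT _ a 0 r s r0.
  - apply/within_continuousP => t; rewrite /= in_itv /= => /andP[t0 tr].
    apply: (cont_at_subset (I := `[0, +oo[)); last exact: ca.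
    by move=> u; rewrite /= !in_itv /= => /andP[->].
  - by rewrite a0 ge_min s0 le_max (ltW sr) orbT.
  - by rewrite in_itv /= => /andP[c0 _] <-; exists c.
have : forall s, exists r, 0 <= s -> 0 <= r /\ a r = s.
  move=> s; have [s0|ns] := boolP (0 <= s); last by exists 0.
  by have [r] := surj s s0; exists r.
move=> /choice[b bP].
have b_ge0 s : 0 <= s -> 0 <= b s by move=> /bP[].
have abK s : 0 <= s -> a (b s) = s by move=> /bP[].
have lt_b r s : 0 <= r -> 0 <= s -> a r < s -> r < b s.
  move=> r0 s0 ars; rewrite ltNge; apply/negP => bsr.
  by have := class_Kinf_le Ka (b_ge0 s s0) bsr; rewrite abK // leNgt ars.
have gt_b r s : 0 <= r -> 0 <= s -> s < a r -> b s < r.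
  move=> r0 s0 ars; rewrite ltNge; apply/negP => bsr.
  by have := class_Kinf_le Ka r0 bsr; rewrite abK // leNgt ars.
have le_b r s : 0 <= r -> 0 <= s -> a r <= s -> r <= b s.
  move=> r0 s0 ars; rewrite leNgt; apply/negP => bsr.
  by have := ai _ _ (b_ge0 s s0) bsr; rewrite abK // ltNge ars.
exists b => //; apply/class_KinfP; split.
- move=> t t0 e e0; have bt0 := b_ge0 t t0.
  have up : 0 < a (b t + e) - t.
    by rewrite subr_gt0 -{1}(abK t t0); apply: ai => //; rewrite ltrDl.
  (* When [b t - e] is negative the lower estimate is automatic from [0 <= b u], and any positive
     tolerance will do. *)
  pose d2 := if b t - e < 0 then 1 else t - a (b t - e).
  have d20 : 0 < d2.
    rewrite /d2; have [//|be] := ltP (b t - e) 0.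
    by rewrite subr_gt0 -{2}(abK t t0); apply: ai => //; rewrite ltrBlDr ltrDl.
  exists (Num.min (a (b t + e) - t) d2); first by rewrite lt_min up.
  move=> u; rewrite /= in_itv /= andbT => u0; rewrite lt_min !ltr_distl.
  move=> /andP[/andP[_ u1] /andP[u2 _]]; rewrite ler_distl; apply/andP; split.
    have [be|be] := ltP (b t - e) 0; first by rewrite (le_trans (ltW be)) ?b_ge0.
    apply/ltW/lt_b => //; move: u2; rewrite /d2 (ltNge (b t - e)) be /=; lra.
  apply/ltW/gt_b => //; first by rewrite addr_ge0 // ltW.
  by move: u1; lra.
- move=> r s r0 rs; apply: lt_b; rewrite ?b_ge0 ?abK //.
  by apply: le_trans (ltW rs).
- apply/eqP; rewrite eq_le b_ge0 // andbT leNgt; apply/negP => b00.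
  by have := ai _ _ (lexx 0) b00; rewrite abK // a0 ltxx.
- move=> B; have B0 : 0 <= `|B| + 1 by rewrite addr_ge0.
  have aB0 := class_Kinf_ge0 Ka B0; exists (a (`|B| + 1)) => //.
  apply: (@lt_le_trans _ _ (`|B| + 1)).
    by rewrite (le_lt_trans (ler_norm _)) // ltrDl.
  exact: le_b.
Qed.

End ClassK.

Section Stability.
Context {R : realType} {n m : nat} (f : 'I_m -> 'rV[R]_n -> 'rV[R]_n).

Lemma weak_lyapunov_like_stable TT chi V : (forall g, continuous (f g)) ->
  TT `<=` covered_trajectories f chi ->
  weak_lyapunov_like f TT chi V -> uniformly_stable TT.
Proof.
move=> cf cov wV; have [_ [a1 [a2 [K1 K2 Va]]] _ _] := wV.
have [b1 Kb1 b1P] := class_Kinf_inv K1.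
(* The added [r] ensures [r <= phi r], so that modes never visited may be counted as well. *)
pose phi r := b1 (a2 r) + r.
have Kphi : class_Kinf phi.
  by apply: class_Kinf_add; [exact: (class_Kinf_comp Kb1 K2)|exact: class_Kinf_id].
have phi_ge r : 0 <= r -> r <= phi r.
  by move=> r0; rewrite lerDr; do 2!apply: class_Kinf_ge0 => //.
exists (iter m phi); first exact: class_Kinf_iter.
move=> p TTp; have [_ _ mono] := weak_lyapunov_like_monotone cov wV TTp.
have [pmax pchi] := cov p TTp.
have [[_ rs] [/solutionP[tI cx _] _]] := pmax.
(* The bound is proved on the still unknown domain; taken from time 0, it then forces the domain to
   be all of R_+. *)
have bd t0 t : 0 <= t0 -> t0 <= t -> dom p t ->
    enorm (state p t) <= iter m phi (enorm (state p t0)).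
  apply: (bound_by_modes (h := fun t => enorm (state p t)) tI rs).
  - move=> u Iu; apply: (cont_at_comp (W := enorm)); last exact: cx.
    exact: enorm_continuous.
  - by move=> u _; exact: enorm_ge0.
  - by move=> r u r0 ru; exact: class_Kinf_le.
  - exact: phi_ge.
  - move=> u u' Iu Iu' uu' suu'.
    have [_ V2] := Va _ _ (pchi u Iu); have [V1 _] := Va _ _ (pchi u' Iu').
    have := mono u u' Iu Iu' uu' suu' => V3.
    apply: (@le_trans _ _ (b1 (a2 (enorm (state p u))))).
      apply: b1P; first exact: enorm_ge0.
        by apply: class_Kinf_ge0 => //; exact: enorm_ge0.
      exact: le_trans V1 (le_trans V3 V2).
    by rewrite lerDl enorm_ge0.
have domE : dom p = `[0, +oo[%classic.
  apply: (bounded_maximal_global cf (B := iter m phi (enorm (state p 0))) pmax).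
  move=> t It; apply: le_trans (norm_le_enorm _) _; apply: bd => //.
  exact: time_domain_ge0 tI It.
split=> // t0 t t00 t0t; apply: bd => //.
by rewrite domE /= in_itv /= andbT (le_trans t00).
Qed.

End Stability.

(** * Limits of trajectories *)

Section MonotoneCounters.
Context {R : realType}.

Lemma nat_has_min (P : nat -> Prop) : (exists k, P k) ->
  exists2 k, P k & forall j, P j -> (k <= j)%N.
Proof.
move=> [k Pk]; apply: contrapT => nmin; elim/ltn_ind: k Pk => k IH Pk.
apply: nmin; exists k => // j Pj; rewrite leqNgt; apply/negP => jk.
exact: IH Pj.
Qed.

Lemma nondecreasing_nat_right (M : R -> nat) t : 0 <= t ->
  (forall u v, 0 <= u -> u <= v -> (M u <= M v)%N) ->
  exists2 d, 0 < d & forall u v, t < u -> u < t + d -> t < v -> v < t + d -> M u = M v.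
Proof.
move=> t0 incM.
have [|j [w [tw wj]] jmin] := nat_has_min (P := fun j => exists w, t < w /\ M w = j).
  by exists (M (t + 1)), (t + 1); rewrite ltrDl.
have cst u : t < u -> u < w -> M u = j.
  move=> tu uw; apply/eqP; rewrite eqn_leq jmin ?andbT; last by exists u.
  by rewrite -wj incM //; apply: ltW => //; apply: le_lt_trans tu.
exists (w - t); first by rewrite subr_gt0.
by rewrite subrKC => u v tu uw tv vw; rewrite !cst.
Qed.

(** Before [t] the counter is bounded by [M t], so the gap to [M t] has a least value; once it is
    reached, the counter is constant up to [t]. *)
Lemma nondecreasing_nat_left (M : R -> nat) t : 0 < t ->
  (forall u v, 0 <= u -> u <= v -> (M u <= M v)%N) ->
  exists2 p, 0 <= p < t & forall u v, p < u -> u < t -> p < v -> v < t -> M u = M v.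
Proof.
move=> t0 incM.
have [|j [w [w0 wt wj]] jmin] := nat_has_min
  (P := fun j => exists w, [/\ 0 <= w, w < t & (M t - M w)%N = j]).
  by exists (M t - M 0%R)%N, 0.
have cst u : w < u -> u < t -> M u = M w.
  move=> wu ut; have u0 : 0 <= u by apply: le_trans (ltW wu).
  have := jmin (M t - M u)%N (ex_intro _ u (And3 u0 ut erefl)).
  by have := incM w u w0 (ltW wu); have := incM u t u0 (ltW ut); lia.
by exists w; [rewrite w0|move=> u v wu ut wv vt; rewrite !cst].
Qed.

End MonotoneCounters.

Section Orbits.
Context {R : realType} {n m : nat} (f : 'I_m -> 'rV[R]_n -> 'rV[R]_n).
Context (chi : 'I_m -> set 'rV[R]_n) (V : 'I_m -> 'rV[R]_n -> R).
Implicit Types (x y : R -> 'rV[R]_n) (s : R -> 'I_m).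

(** The properties preserved by both time shifts and ultralimits; dwell-time enters through the
    existence of a counter. *)
Record bounded_orbit (tau : R) (N0 : nat) (rho : R) x s : Prop := BoundedOrbit {
  orbit_solution : solution f `[0, +oo[ x s;
  orbit_right_continuous : right_continuous_signal s;
  orbit_jump_count : exists N, jump_count tau N0 s N;
  orbit_cover : forall t, 0 <= t -> chi (s t) (x t);
  orbit_bound : forall t, 0 <= t -> `|x t| <= rho;
  orbit_monotone : forall t t', 0 <= t -> t <= t' -> s t = s t' ->
     V (s t') (x t') <= V (s t) (x t) }.

Lemma bounded_orbit_shift tau N0 rho x s a : 0 <= a ->
  bounded_orbit tau N0 rho x s ->
  bounded_orbit tau N0 rho (fun t => x (a + t)) (fun t => s (a + t)).
Proof.
move=> a0 [/solutionP[tI cx dx] rs [N jN] cov bd mono].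
have mem t : 0 <= t -> `[0, +oo[%classic (a + t).
  by move=> t0; rewrite /= in_itv /= andbT addr_ge0.
have dist u t : a + u - (a + t) = u - t by ring.
split.
- apply/solutionP; split=> //.
    move=> t; rewrite /= in_itv /= andbT => t0 e e0.
    have [d d0 dP] := cx _ (mem t t0) e e0.
    exists d => // u; rewrite /= in_itv /= andbT => u0 ut.
    by apply: dP; [exact: mem|rewrite dist].
  move=> t; rewrite /= in_itv /= andbT => t0 ns e e0.
  (* Time 0 is a switching time of the shifted signal by convention, so nothing is claimed there; at
     positive times the switching times simply move by [a]. *)
  have tpos : 0 < t.
    rewrite lt_neqAle t0 andbT; apply/eqP => t0'; apply: ns; left.
    exact: esym.
  have nst : ~ switching_time s (a + t).
    move: ns => /(not_switching_timeP _ tpos)[d d0 dP].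
    apply/not_switching_timeP; first by rewrite ltr_wpDl.
    exists d => // u ut; have -> : u = a + (u - a) by ring.
    by apply: dP; rewrite -(dist (u - a) t) subrKC.
  have [d d0 dP] := dx _ (mem t t0) nst e e0.
  exists d => // u; rewrite /= in_itv /= andbT => u0 ut.
  have := dP (a + u) (mem u u0); rewrite dist; exact.
- exact: right_continuous_shift.
- by exists (fun t => N (a + t)); exact: jump_count_shift.
- by move=> t t0; apply: cov; rewrite addr_ge0.
- by move=> t t0; apply: bd; rewrite addr_ge0.
- move=> t t' t0 tt' stt'; apply: mono => //; first by rewrite addr_ge0.
  by rewrite lerD2l.
Qed.

Lemma jump_count_normalize tau (N0 : nat) s : (exists N, jump_count tau N0 s N) ->
  exists2 N, jump_count tau N0 s N & N 0 = 0%N.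
Proof.
move=> [N [N1 N2 N3]]; exists (fun u => N u - N 0%R)%N; last by rewrite subnn.
split=> u v u0 uv.
- by apply: leq_sub2r; exact: N1.
- move=> NE; apply: N2 => //.
  by have := N1 0%R u (lexx _) u0; have := N1 u v u0 uv; move: NE; lia.
- rewrite !natrB ?N1 //; last exact: le_trans uv.
  by have := N3 u v u0 uv; lra.
Qed.

Section Limit.
Variables (U : set_system nat) (tau : R) (N0 : nat) (rho : R).
Hypothesis UU : UltraFilter U.
Variables (xk : nat -> R -> 'rV[R]_n) (sk : nat -> R -> 'I_m).
Hypothesis orb : forall k, bounded_orbit tau N0 rho (xk k) (sk k).

(** Counters normalised to vanish at 0 are bounded at time [u] by [N0 + u / tau] for every [k],
    hence have a limit. Equality of the limits at [u] and [v] yields a single large set of indices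
    whose signals are constant on all of [[u, v]], which pointwise convergence alone would not
    give. *)
Lemma ultralimit_counter : exists M : R -> nat, exists S : R -> 'I_m,
  [/\ forall t, 0 <= t -> \forall k \near U, sk k t = S t,
      forall u v, 0 <= u -> u <= v -> M u = M v ->
        \forall k \near U, forall c, u <= c -> c <= v -> sk k c = S u
    & jump_count tau N0 S M].
Proof.
have /choice[Nk NkP] : forall k, exists N, jump_count tau N0 (sk k) N /\ N 0 = 0%N.
  by move=> k; have [N jN Nz] := jump_count_normalize (orbit_jump_count (orb k)); exists N.
have lim u : exists j, 0 <= u -> \forall k \near U, Nk k u = j.
  have [u0|nu] := boolP (0 <= u); last by exists 0%N.
  have [|j jP] := @ultra_bounded_nat _ U (fun k => Nk k u) (Num.truncn (N0%:R + (u - 0) / tau)) UU.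
    apply: nearW => k; have [[N1 N2 N3] N00] := NkP k.
    have := N3 0 u (lexx _) u0; rewrite N00 add0r => h.
    by rewrite truncn_ge_nat //; apply: le_trans h.
  by exists j.
have /choice[M MP] := lim.
have /choice[S SP] : forall u, exists g, \forall k \near U, sk k u = g.
  by move=> u; exact: ultra_ord.
have M1 u v : 0 <= u -> u <= v -> (M u <= M v)%N.
  move=> u0 uv; have [k [<- <-]] := filter_ex (filterI (MP u u0) (MP v (le_trans u0 uv))).
  by have [[N1 _ _] _] := NkP k; exact: N1.
have M2 u v : 0 <= u -> u <= v -> M u = M v ->
    \forall k \near U, forall c, u <= c -> c <= v -> sk k c = S u.
  move=> u0 uv Muv.
  apply: filterS3 (MP u u0) (MP v (le_trans u0 uv)) (SP u) => k ku kv <- c uc cv.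
  have [[N1 N2 _] _] := NkP k; apply/esym/N2 => //; apply/eqP.
  rewrite eqn_leq N1 //= ku Muv -kv; apply: N1 => //; exact: le_trans uc.
exists M, S; split=> //; split=> // u v u0 uv.
  move=> /(M2 u v u0 uv) h; have [k [h1 h2]] := filter_ex (filterI h (SP v)).
  by rewrite -h2 h1.
have [k [<- <-]] := filter_ex (filterI (MP u u0) (MP v (le_trans u0 uv))).
by have [[_ _ N3] _] := NkP k; exact: N3.
Qed.

End Limit.

(* The pointwise limit [S] of the signals need not be right-continuous; the
   signal of the limit orbit is its right limit. *)
Lemma right_limit_jump_count tau (N0 : nat) (S : R -> 'I_m) M :
  jump_count tau N0 S M ->
  exists2 s, right_continuous_signal s /\ (exists N, jump_count tau N0 s N) &
    forall t, 0 <= t -> exists2 d, 0 < d &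
      forall u, t < u -> u < t + d -> S u = s t.
Proof.
move=> [M1 M2 M3].
(* [z t] packs the right limits of the counter and of the signal at [t] with a radius within which
   both are attained. *)
have : forall t, exists z : nat * 'I_m * R, 0 <= t -> 0 < z.2 /\
    forall u, t < u -> u < t + z.2 -> M u = z.1.1 /\ S u = z.1.2.
  move=> t; have [t0|nt] := boolP (0 <= t); last by exists (0%N, S 0, 0).
  have [d d0 dP] := nondecreasing_nat_right t0 M1.
  have d2 : t < t + d / 2 by rewrite ltrDl divr_gt0.
  have d2d : t + d / 2 < t + d by rewrite ltrD2l; lra.
  exists (M (t + d / 2), S (t + d / 2), d) => _; split=> //= u tu utd.
  have ME := dP _ _ tu utd d2 d2d; split=> //.
  have u0 : 0 <= u by apply: le_trans (ltW tu).
  have [ud|du] := leP u (t + d / 2); first exact: M2.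
  by apply/esym/M2 => //; [lra|exact: ltW].
move=> /choice[z zP].
exists (fun t => (z t).1.2); last first.
  by move=> t t0; have [d0 dP] := zP t t0; exists (z t).2 => // u tu /dP[].
split.
  apply: right_continuous_signalI => t t0; have [d0 dP] := zP t t0.
  exists (z t).2 => // u; rewrite le_eqVlt => /predU1P[->//|tu] utd.
  have u0 : 0 <= u by apply: le_trans (ltW tu).
  have [du0 duP] := zP u u0.
  pose v := Num.min ((u + (t + (z t).2)) / 2) (u + (z u).2 / 2).
  have [uv vt vu] : [/\ u < v, v < t + (z t).2 & v < u + (z u).2].
    rewrite /v !gt_min lt_min; split; first by apply/andP; split; lra.
      by apply/orP; left; lra.
    by apply/orP; right; lra.
  have [_ <-] := duP v uv vu; have [_ ->//] := dP v (lt_trans tu uv) vt.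
(* A common shift [e] realises both right limits and preserves [v - u], so each property of the
   counter transfers. *)
have both u v : 0 <= u -> u <= v -> exists2 e, 0 < e &
    [/\ M (u + e) = (z u).1.1, S (u + e) = (z u).1.2,
        M (v + e) = (z v).1.1 & S (v + e) = (z v).1.2].
  move=> u0 uv; have [du0 duP] := zP u u0; have [dv0 dvP] := zP v (le_trans u0 uv).
  pose e := Num.min ((z u).2 / 2) ((z v).2 / 2).
  have [e0 eu ev] : [/\ 0 < e, e < (z u).2 & e < (z v).2].
    rewrite /e !gt_min lt_min; split; first by apply/andP; split; lra.
      by apply/orP; left; lra.
    by apply/orP; right; lra.
  exists e => //.
  have [-> ->] := duP (u + e) ltac:(lra) ltac:(lra).
  by have [-> ->] := dvP (v + e) ltac:(lra) ltac:(lra).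
exists (fun t => (z t).1.1); split=> u v u0 uv.
- have [e e0 [<- _ <- _]] := both u v u0 uv; apply: M1; lra.
- by have [e e0 [<- <- <- <-]] := both u v u0 uv => ?; apply: M2 => //; lra.
- have [e e0 [<- _ <- _]] := both u v u0 uv.
  have := M3 (u + e) (v + e) ltac:(lra) ltac:(lra).
  by have -> : v + e - (u + e) = v - u by ring.
Qed.

End Orbits.

Section OrbitLimit.
Context {R : realType} {n m : nat} (f : 'I_m -> 'rV[R]_n -> 'rV[R]_n).
Context (chi : 'I_m -> set 'rV[R]_n) (V : 'I_m -> 'rV[R]_n -> R).
Hypothesis cf : forall g, continuous (f g).
Hypothesis closed_chi : forall g, closed (chi g).
Hypothesis cV : forall g, continuous (V g).
Variables (U : set_system nat) (tau : R) (N0 : nat) (rho : R).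
Hypothesis UU : UltraFilter U.
Variables (xk : nat -> R -> 'rV[R]_n) (sk : nat -> R -> 'I_m).
Hypothesis orb : forall k, bounded_orbit f chi V tau N0 rho (xk k) (sk k).

Lemma lipschitz_cvg_right (y : R -> 'rV[R]_n) L t : 0 < L ->
  (forall u, t <= u -> `|y u - y t| <= L * (u - t)) -> y u @[u --> t^'+] --> y t.
Proof.
move=> L0 lip; apply/cvgrPdist_le => e e0.
exists (e / L); first by rewrite /= divr_gt0.
move=> u /= utd tu; rewrite distrC; apply: le_trans (lip u (ltW tu)) _.
move: utd; rewrite distrC gtr0_norm ?subr_gt0 // ltr_pdivlMr // mulrC.
exact: ltW.
Qed.

Lemma lipschitz_comp_cvg_right (y : R -> 'rV[R]_n) (W : 'rV[R]_n -> R) L r :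
  0 < L -> continuous W -> (forall u, r <= u -> `|y u - y r| <= L * (u - r)) ->
  W (y (r + e)) @[e --> 0^'+] --> W (y r).
Proof.
move=> L0 cW lip.
apply: (@cvg_comp _ _ _ (fun e => y (r + e)) W _ (nbhs (y r))); last exact: cW.
rewrite -{2}[r]addr0; apply: (lipschitz_cvg_right (y := fun e => y (r + e)) L0).
move=> e e0; rewrite addr0; apply: le_trans (lip (r + e) _) _.
  by rewrite lerDl.
by rewrite addrAC subrr add0r subr0.
Qed.

Lemma bounded_orbit_lipschitz L x s : 0 < L ->
  (forall g xi, `|xi| <= rho -> `|f g xi| <= L) ->
  bounded_orbit f chi V tau N0 rho x s ->
  forall t u, 0 <= t -> t <= u -> `|x u - x t| <= L * (u - t).
Proof.
move=> L0 LP [sol rs _ _ bd _] t u t0 tu; apply: (solution_lipschitz sol rs t0 tu).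
  by rewrite /= in_itv /= andbT (le_trans t0 tu).
by move=> c tc cu; apply/LP/bd; exact: le_trans tc.
Qed.

Lemma bounded_orbit_limit : exists y s,
  [/\ bounded_orbit f chi V tau N0 rho y s,
      forall t, 0 <= t -> xk ^~ t @ U --> (y t : 'rV[R]_n)
    & forall t, 0 <= t -> exists2 d, 0 < d &
        forall u, t < u -> u < t + d -> \forall k \near U, sk k u = s t].
Proof.
have PU : ProperFilter U by exact: ultra_proper.
have [M [S [SP MS jM]]] := ultralimit_counter UU orb.
have [s [rs jN] sS] := right_limit_jump_count jM.
have [M1 M2 M3] := jM.
have [L L0 LP] := continuous_bounded_ball cf rho.
have lipk k := bounded_orbit_lipschitz L0 LP (orb k).
have : forall t, exists z : 'rV[R]_n, 0 <= t -> xk ^~ t @ U --> z.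
  move=> t; have [t0|nt] := boolP (0 <= t); last by exists 0.
  have [|z zP] := @ultra_bounded_cvg _ _ _ U (xk ^~ t) rho UU.
    by apply: nearW => k; exact: (orbit_bound (orb k)).
  by exists z.
move=> /choice[y yP].
have lipy t u : 0 <= t -> t <= u -> `|y u - y t| <= L * (u - t).
  move=> t0 tu; have u0 := le_trans t0 tu.
  apply: (cvg_norm_le PU (cvgB (yP u u0) (yP t t0))).
  by apply: nearW => k; exact: lipk.
have cy t : 0 <= t -> cont_at `[0, +oo[ y t.
  move=> t0 e e0; exists (e / L); first by rewrite divr_gt0.
  move=> u; rewrite /= in_itv /= andbT => u0.
  rewrite ltr_pdivlMr // => ute; apply: le_trans (ltW ute).
  have [tu|/ltW ut] := leP t u.
    by rewrite ger0_norm ?subr_ge0 // mulrC lipy.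
  by rewrite distrC (distrC u) ger0_norm ?subr_ge0 // mulrC lipy.
have sk_s t : 0 <= t -> exists2 d, 0 < d &
    forall u, t < u -> u < t + d -> \forall k \near U, sk k u = s t.
  move=> t0; have [d d0 dP] := sS t t0; exists d => // u tu utd.
  by rewrite -(dP u tu utd); apply: SP; apply: le_trans (ltW tu).
have ycvg t : 0 <= t -> y u @[u --> t^'+] --> y t.
  by move=> t0; apply: (lipschitz_cvg_right L0) => u tu; exact: lipy.
(* The counter may jump at an end point at which the limit signal is
   continuous, so the two sides of such a point are treated separately. *)
have dy p q g : 0 <= p -> (forall u v, p < u -> u < q -> p < v -> v < q -> M u = M v) ->
    (forall u, p < u -> u < q -> S u = g) ->
    forall c, p <= c -> c <= q -> deriv_at `[p, q] y c (f g (y c)).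
  move=> p0 Mcst Scst.
  have sub : `[p, q] `<=` `[0, +oo[.
    by move=> u; rewrite /= !in_itv /= andbT => /andP[pu _]; exact: le_trans pu.
  apply: (deriv_at_endpoints (@cf g)).
    by move=> c pc cq; apply: (cont_at_subset sub); apply: cy; exact: le_trans pc.
  move=> c pc cq; pose a := (p + c) / 2; pose b := (c + q) / 2.
  have [pa ac cb bq] : [/\ p < a, a < c, c < b & b < q].
    by rewrite /a /b; split; lra.
  have a0 : 0 <= a by lra.
  (* Strictly inside the interval [M] takes the same value at [a] and [b], so for a large set of [k]
     the orbit [xk k] follows the one mode [g] throughout [[a, b]]. *)
  have : deriv_at `[a, b] y c (f g (y c)).
    apply: (@cvg_filter_deriv _ _ U xk y (f g) L a b PU (@cf g)) => //; try exact: ltW.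
    - by move=> t at_ tb; apply: yP; exact: le_trans at_.
    - move=> eta eta0; apply: nearW => k t u at_ tu ub.
      by apply: ler_wpDr; [exact: ltW|apply: lipk => //; exact: le_trans at_].
    - move=> w e eta eta0.
      have Mab : M a = M b by apply: Mcst; lra.
      have := MS a b a0 ltac:(lra) Mab.
      apply: filterS => k; rewrite (Scst a pa) => [skg|]; last by lra.
      move=> t u at_ tu ub H; apply: ler_wpDr; first exact: ltW.
      have t0 := le_trans a0 at_.
      apply: (solution_mean_value (g := g) (orbit_solution (orb k))) => //.
      + by rewrite /= in_itv /= andbT (le_trans t0 tu).
      + by move=> v tv vu; apply: skg; lra.
      + by move=> v tv vu; apply: H; exact: ltW.
  apply: (@deriv_at_local _ _ _ _ _ _ _ _ (Num.min (c - a) (b - c))) => //.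
    by rewrite lt_min !subr_gt0 ac.
  move=> u _; rewrite lt_min !ltr_distl => /andP[/andP[? _] /andP[_ ?]].
  by split=> //; rewrite /= in_itv /=; apply/andP; split; lra.
exists y, s; split=> //; split=> //.
- apply/solutionP; split.
  + by apply: Or33.
  + by move=> t; rewrite /= in_itv /= andbT; exact: cy.
  + move=> t; rewrite /= in_itv /= andbT => t0 ns.
    have tpos : 0 < t.
      by rewrite lt_neqAle t0 andbT; apply/eqP => t0'; apply: ns; left; exact: esym.
    have [d1 d10 d1P] := nondecreasing_nat_right t0 M1.
    have [p /andP[p0 pt] pP] := nondecreasing_nat_left tpos M1.
    have [d2 d20 d2P] := sS t t0.
    have /(not_switching_timeP _ tpos)[d3 d30 d3P] := ns.
    pose d := Num.min d1 d2.
    have [d0 dd1 dd2] : [/\ 0 < d, d <= d1 & d <= d2].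
      by rewrite /d lt_min d10 d20 !ge_min !lexx orbT.
    have dr : deriv_at `[t, t + d] y t (f (s t) (y t)).
      apply: dy => //; last by rewrite lerDl ltW.
        by move=> u v tu utd tv vtd; apply: d1P; lra.
      by move=> u tu utd; apply: d2P; lra.
    pose p' := Num.max p (t - d3).
    have [pp' p't tp'] : [/\ p <= p', p' < t & t - d3 <= p'].
      by rewrite /p' gt_max !le_max !lexx orbT pt; split=> //=; lra.
    have dl : deriv_at `[p', t] y t (f (s t) (y t)).
      apply: dy; [exact: le_trans pp'| | |exact: ltW|exact: lexx].
        by move=> u v pu ut pv vt; apply: pP; lra.
      move=> u pu ut.
      have u0 : 0 <= u by apply: le_trans p0 (le_trans pp' (ltW pu)).
      have [e e0 eP] := sS u u0.
      (* Left of [t] the counter does not jump, so [S u] agrees with its right limit [s u], which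
         equals [s t] as [t] is no switching time. *)
      pose v := Num.min ((u + t) / 2) (u + e / 2).
      have [uv vt vu] : [/\ u < v, v < t & v < u + e].
        rewrite /v !gt_min lt_min; split; first by apply/andP; split; lra.
          by apply/orP; left; lra.
        by apply/orP; right; lra.
      have Muv : M u = M v by apply: pP; lra.
      rewrite (M2 u v u0 (ltW uv) Muv) eP //.
      by apply: d3P; rewrite ltr_distl; apply/andP; split; lra.
    apply: (@deriv_at_local _ _ `[p', t + d] _ y y t _ (Num.min (t - p') d)) => //.
    * by rewrite lt_min subr_gt0 p't.
    * move=> u _; rewrite lt_min !ltr_distl => /andP[/andP[? _] /andP[_ ?]].
      by split=> //; rewrite /= in_itv /=; apply/andP; split; lra.
    * exact: (deriv_at_glue (a := p') (b := t + d)).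
- move=> t t0; have [d d0 dP] := sk_s t t0.
  apply: (closed_cvg (chi (s t)) (@closed_chi (s t)) _ _ (ycvg t t0)).
  exists d => //= u utd tu.
  have u0 : 0 <= u by apply: le_trans (ltW tu).
  have utd' : u < t + d by move: utd => /=; rewrite distrC ltr_distl => /andP[].
  apply: (closed_cvg (chi (s t)) (@closed_chi (s t)) _ _ (yP u u0)).
  apply: filterS (dP u tu utd') => k <-.
  exact: (orbit_cover (orb k)).
- move=> t t0; apply: (cvg_norm_le PU (yP t t0)).
  by apply: nearW => k; exact: (orbit_bound (orb k)).
- move=> t t' t0; rewrite le_eqVlt => /predU1P[-> _ //|tt' stt'].
  have t'0 : 0 <= t' by apply: le_trans (ltW tt').
  rewrite -subr_le0 stt'; set g := s t'.
  have shift_cvg r : 0 <= r -> V g (y (r + e)) @[e --> 0^'+] --> V g (y r).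
    move=> r0; apply: (lipschitz_comp_cvg_right L0 (@cV g)) => u ru.
    exact: lipy.
  have Vk r : 0 <= r -> V g (xk k r) @[k --> U] --> V g (y r).
    move=> r0; apply: (@cvg_comp _ _ _ (xk ^~ r) (V g) _ (nbhs (y r))); last exact: cV.
    exact: yP.
  (* The inequality holds for the approximants at [t + e] and [t' + e], where their signals agree
     with [s t] and [s t']; the index goes to the limit before [e] tends to 0. *)
  apply: (cvgr_to_le (cvgB (shift_cvg t' t'0) (shift_cvg t t0))).
  have [d d0 dP] := sk_s t t0; have [d' d'0 d'P] := sk_s t' t'0.
  exists (Num.min d d'); first by rewrite /= lt_min d0.
  move=> e /=; rewrite sub0r normrN => + e0; rewrite gtr0_norm // lt_min => /andP[ed ed'].
  have V1 := Vk (t + e) ltac:(lra).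
  have V2 := Vk (t' + e) ltac:(lra).
  apply: (cvgr_to_le (cvgB V2 V1)).
  have H1 : \forall k \near U, sk k (t + e) = s t by apply: dP; lra.
  have H2 : \forall k \near U, sk k (t' + e) = s t' by apply: d'P; lra.
  apply: filterS2 H1 H2.
  move=> k h1 h2; rewrite subr_le0 /g -{1}h2 -{1}stt' -{1}h1.
  by apply: (orbit_monotone (orb k)); [lra|lra|rewrite h1 h2].
Qed.

End OrbitLimit.

(** * Uniform attractivity *)

Section Attractivity.
Context {R : realType} {n m : nat} (f : 'I_m -> 'rV[R]_n -> 'rV[R]_n).
Context (chi : 'I_m -> set 'rV[R]_n) (V : 'I_m -> 'rV[R]_n -> R).
Hypothesis cf : forall g, continuous (f g).
Hypothesis closed_chi : forall g, closed (chi g).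
Hypothesis cV : forall g, continuous (V g).
Hypothesis maxM : maximal_weakly_invariant
  (level_trajectories f setT V `&` covered_trajectories f chi `&` all_adt_trajectories f)
  ([set 0] `*` [set g | chi g 0]).

Definition level_orbit (y : R -> 'rV[R]_n) (s : R -> 'I_m) := forall t t',
  0 <= t -> 0 <= t' -> s t = s t' -> V (s t) (y t) = V (s t') (y t').

(** From any point [(y t, s t)] the shift by [t] is an admissible trajectory that stays on the
    orbit. The orbit is therefore weakly invariant, and maximality places it in the trivial set. *)
Lemma level_orbit_eq0 tau (N0 : nat) rho y s : 0 < tau -> (0 < N0)%N ->
  bounded_orbit f chi V tau N0 rho y s -> level_orbit y s -> y 0 = 0.
Proof.
move=> tau0 N00 orb lev.
pose p a := @Trajectory R n m `[0, +oo[%classic (fun t => y (a + t)) (fun t => s (a + t)).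
have Tp a : 0 <= a -> (level_trajectories f setT V `&` covered_trajectories f chi
    `&` all_adt_trajectories f) (p a).
  move=> a0; have [sol rs [N jN] cov bd mono] := bounded_orbit_shift a0 orb.
  have adt := jump_count_adt rs jN.
  have maxp : maximal_trajectories f (p a).
    by split; [case: adt|exact: global_solution_maximal].
  have memP t : dom (p a) t -> 0 <= t by rewrite /= in_itv /= andbT.
  split; last by exists tau, N0; split.
  split; last by split=> // t /memP; exact: cov.
  split.
    split=> // t t' /memP t0 /memP t'0 tt' stt'; exact: mono.
  by move=> t t' /memP t0 /memP t'0; apply: lev; rewrite addr_ge0.
pose M' := [set z : 'rV[R]_n * 'I_m | exists2 t, 0 <= t & z = (y t, s t)].
have : weakly_invariant (level_trajectories f setT V `&` covered_trajectories f chi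
    `&` all_adt_trajectories f) M'.
  split; first by exists (y 0, s 0), 0.
  move=> xi g [t t0 [-> ->]]; exists (p t); first exact: Tp.
  rewrite /= !addr0; split=> // u; rewrite in_itv /= andbT => u0.
  by exists (t + u) => //; rewrite addr_ge0.
move=> /(proj2 maxM)/(_ (y 0, s 0)) [|//].
by exists 0.
Qed.

(** [V] becomes level in each mode because visits interlace: whatever the order of [t] and [t'], a
    sufficiently late shift of [t'] comes after a given shift of [t]. Exchanging the two times gives
    equality. *)
Lemma bounded_orbit_omega_limit tau (N0 : nat) rho delta y s :
  bounded_orbit f chi V tau N0 rho y s -> (forall t, 0 <= t -> delta <= enorm (y t)) ->
  exists z q, [/\ bounded_orbit f chi V tau N0 rho z q, level_orbit z q
    & delta <= enorm (z 0)].
Proof.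
move=> orb yd; have [U UU oU] := free_ultrafilter.
have PU : ProperFilter U by exact: ultra_proper.
have orbk k := bounded_orbit_shift (ler0n R k) orb.
have [z [q [orbz zP qP]]] := bounded_orbit_limit cf closed_chi cV UU orbk.
exists z, q; split=> //; last first.
  have ez : enorm (y (k%:R + 0)) @[k --> U] --> enorm (z 0).
    apply: (@cvg_comp _ _ _ (fun k => y (k%:R + 0)) enorm _ (nbhs (z 0))).
      exact: zP.
    exact: enorm_continuous.
  apply: (cvgr_to_ge ez); apply: nearW => k; apply: yd; rewrite addr0; exact: ler0n.
suff le t t' : 0 <= t -> 0 <= t' -> q t = q t' -> V (q t') (z t') <= V (q t') (z t).
  move=> t t' t0 t'0 qtt'; have := le t' t t'0 t0 (esym qtt').
  have := le t t' t0 t'0 qtt'; rewrite qtt' => V1 V2.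
  by apply/eqP; rewrite eq_le V1 V2.
move=> t0 t'0 qtt'; set g := q t'.
have [L L0 LP] := continuous_bounded_ball cf rho.
have lipz := bounded_orbit_lipschitz L0 LP orbz.
have shift_cvg r : 0 <= r -> V g (z (r + e)) @[e --> 0^'+] --> V g (z r).
  move=> r0; apply: (lipschitz_comp_cvg_right L0 (@cV g)) => u ru.
  exact: lipz.
have Vk r : 0 <= r -> V g (y (k%:R + r)) @[k --> U] --> V g (z r).
  move=> r0; apply: (@cvg_comp _ _ _ (fun k => y (k%:R + r)) (V g) _ (nbhs (z r))).
    exact: zP.
  exact: cV.
rewrite -subr_le0; apply: (cvgr_to_le (cvgB (shift_cvg t' t'0) (shift_cvg t t0))).
have [d d0 dP] := qP t t0; have [d' d'0 d'P] := qP t' t'0.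
exists (Num.min d d'); first by rewrite /= lt_min d0.
move=> e /=; rewrite sub0r normrN => + e0; rewrite gtr0_norm // lt_min => /andP[ed ed'].
have H1 : \forall k \near U, s (k%:R + (t + e)) = g.
  by rewrite /g -qtt'; apply: dP; lra.
have H2 : \forall k \near U, s (k%:R + (t' + e)) = g by apply: d'P; lra.
have te0 : 0 <= t + e by lra.
have t'e0 : 0 <= t' + e by lra.
rewrite subr_le0; apply: (cvgr_to_ge (Vk (t + e) te0)).
apply: filterS H1 => k sk; apply: (cvgr_to_le (Vk (t' + e) t'e0)).
(* With [k] fixed, [k'] is taken so large that its time comes later. The limit in [k'] is taken
   inside that in [k]. *)
have big : \forall k' \near U, k%:R + (t + e) <= k'%:R + (t' + e).
  apply: oU; exists (k + (Num.truncn (t + e)).+1)%N => // k' /= kk'.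
  have : (k + (Num.truncn (t + e)).+1)%:R <= k'%:R :> R by rewrite ler_nat.
  by have := truncnS_gt (t + e); rewrite natrD; lra.
apply: filterS2 H2 big => k' sk' kk'.
have := orbit_monotone orb (t := k%:R + (t + e)) (t' := k'%:R + (t' + e)).
rewrite sk sk'; apply=> //; exact: addr_ge0.
Qed.

(** The shared [tau] and [N0] put the shifts of all members of [TT] into one class [bounded_orbit];
    stability supplies the outer bound [a r] and the inner radius [delta]. *)
Lemma uniform_attractivity TT a tau (N0 : nat) : 0 < tau -> (0 < N0)%N ->
  class_Kinf a ->
  (forall p, TT p -> dom p = `[0, +oo[%classic /\
    forall t0 t, 0 <= t0 -> t0 <= t -> enorm (state p t) <= a (enorm (state p t0))) ->
  TT `<=` adt_trajectories f tau N0 -> TT `<=` covered_trajectories f chi ->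
  TT `<=` monotone_trajectories f setT V ->
  forall r e, 0 < e -> exists2 T, 0 <= T & forall p, TT p -> forall t0 t, 0 <= t0 ->
    enorm (state p t0) <= r -> t0 + T <= t -> enorm (state p t) <= e.
Proof.
move=> tau0 N00 Ka stab adt cov mono r e e0; apply: contrapT => noT.
have bad (k : nat) : exists ptu : trajectory R n m * R * R,
   [/\ TT ptu.1.1, 0 <= ptu.1.2, enorm (state ptu.1.1 ptu.1.2) <= r,
       ptu.1.2 + k%:R <= ptu.2 & e < enorm (state ptu.1.1 ptu.2)].
  apply: contrapT => nbad; apply: noT; exists k%:R => // p TTp t0 t t00 xr tT.
  by rewrite leNgt; apply/negP => ex; apply: nbad; exists (p, t0, t).
have [ptu ptuP] := choice bad.
(* A state of norm at most [delta] never exceeds [e] afterwards, so a trajectory still above [e] at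
   a late time has stayed outside this ball until then. *)
have [delta delta0 adelta] : exists2 delta, 0 < delta & a delta <= e.
  have [/within_continuousP ca _ a0] := Ka.1.
  have [|d d0 dP] := ca 0 _ e e0; first by rewrite /= in_itv /= lexx.
  exists (d / 2); first by rewrite divr_gt0.
  have d20 : 0 < d / 2 by rewrite divr_gt0.
  apply: le_trans (ler_norm _) _; rewrite -[a _]subr0 -a0; apply: dP.
    by rewrite /= in_itv /= andbT ltW.
  by rewrite subr0 gtr0_norm //; lra.
pose xk k t := state (ptu k).1.1 ((ptu k).1.2 + t).
pose sk k t := signal (ptu k).1.1 ((ptu k).1.2 + t).
have orb k : bounded_orbit f chi V tau N0 (a r) (xk k) (sk k).
  have [TTp t00 xr _ _] := ptuP k; have [domE bd] := stab _ TTp.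
  have r0 : 0 <= r by apply: le_trans xr; exact: enorm_ge0.
  have [pmax [sw sadt]] := adt _ TTp.
  have mem t : 0 <= t -> dom (ptu k).1.1 t by rewrite domE /= in_itv /= andbT.
  have orb0 : bounded_orbit f chi V tau N0 (a (enorm (state (ptu k).1.1 0)))
      (state (ptu k).1.1) (signal (ptu k).1.1).
    split.
    - by have [_ [sol _]] := pmax; rewrite -domE.
    - by case: sw.
    - exact: adt_jump_count.
    - by move=> t t0; apply: (cov _ TTp).2; exact: mem.
    - by move=> t t0; apply: le_trans (norm_le_enorm _) _; exact: bd.
    - move=> t t' t0 tt'; have [_ _ mp] := mono _ TTp; apply: mp => //; apply: mem => //.
      exact: le_trans tt'.
  (* The bound taken from time 0 depends on [k]; stability from the start of the shift replaces it
     by [a r]. *)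
  have [sol rs jN cv _ mn] := bounded_orbit_shift t00 orb0.
  split=> // t t0; apply: le_trans (norm_le_enorm _) _.
  apply: le_trans (bd (ptu k).1.2 _ t00 _) _; first by rewrite lerDl.
  by apply: class_Kinf_le => //; exact: enorm_ge0.
have far k t : 0 <= t -> t <= k%:R -> delta <= enorm (xk k t).
  move=> t0 tk; have [TTp t00 xr tu ex] := ptuP k; have [domE bd] := stab _ TTp.
  rewrite leNgt; apply/negP => xd.
  have := bd ((ptu k).1.2 + t) (ptu k).2 ltac:(by rewrite addr_ge0) ltac:(lra).
  have := class_Kinf_le Ka (enorm_ge0 _) (ltW xd); rewrite -/(xk k t); lra.
have [U UU oU] := free_ultrafilter.
have PU : ProperFilter U by exact: ultra_proper.
have [y [s [orby yP _]]] := bounded_orbit_limit cf closed_chi cV UU orb.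
have yd t : 0 <= t -> delta <= enorm (y t).
  move=> t0; have ey : enorm (xk k t) @[k --> U] --> enorm (y t).
    apply: (@cvg_comp _ _ _ (xk ^~ t) enorm _ (nbhs (y t))); first exact: yP.
    exact: enorm_continuous.
  apply: (cvgr_to_ge ey); apply: oU; exists (Num.truncn t).+1 => // k /= tk.
  apply: far => //; apply: ltW; apply: lt_le_trans (truncnS_gt t) _.
  by rewrite ler_nat.
have [z [q [orbz lev zd]]] := bounded_orbit_omega_limit orby yd.
by move: zd; rewrite (level_orbit_eq0 tau0 N00 orbz lev) enorm0 leNgt delta0.
Qed.

End Attractivity.

(** * Construction of the comparison function *)

Section ComparisonFunction.
Context {R : realType} {n m : nat} (TT : set (trajectory R n m)) (a : R -> R).
Hypothesis Ka : class_Kinf a.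
Hypothesis stab : forall p, TT p -> dom p = `[0, +oo[%classic /\
    forall t0 t, 0 <= t0 -> t0 <= t -> enorm (state p t) <= a (enorm (state p t0)).
Hypothesis attr : forall r e, 0 < e -> exists2 T, 0 <= T & forall p, TT p -> forall t0 t,
  0 <= t0 -> enorm (state p t0) <= r -> t0 + T <= t -> enorm (state p t) <= e.

(* Lipschitz in [r], hence so is the supremum [late_sup]; cutting off at
   [s = r] exactly would not be continuous. *)
Definition cutoff (s r : R) := Num.max 0 (Num.min 1 (r + 1 - s)).

(** Norms reached at least [t] after a state of norm below [r + 1], faded out as that norm goes from
    [r] to [r + 1]. The value 0 keeps the set nonempty even for an empty family. *)
Definition late_values r t := [set v | v = 0 \/ exists p t0 t',
  [/\ TT p, 0 <= t0, t0 + t <= t' &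
      v = enorm (state p t') * cutoff (enorm (state p t0)) r]].

Definition late_sup r t := sup (late_values r t).

Lemma cutoff_itv s r : 0 <= cutoff s r <= 1.
Proof. by rewrite /cutoff le_max lexx ge_max ler01 ge_min lexx. Qed.

Lemma cutoff1 s r : s <= r -> cutoff s r = 1.
Proof. by move=> sr; rewrite /cutoff min_l ?max_r //; lra. Qed.

Lemma cutoff_eq0 s r : r + 1 <= s -> cutoff s r = 0.
Proof. by move=> sr; rewrite /cutoff max_l // ge_min; apply/orP; right; lra. Qed.

Lemma cutoff_le s r r' : r <= r' -> cutoff s r <= cutoff s r' <= cutoff s r + (r' - r).
Proof.
move=> rr'; rewrite /cutoff !minEle.
by do ![case: ifPn; rewrite -?ltNge => ?]; rewrite !maxEle;
  do ![case: ifPn; rewrite -?ltNge => ?]; apply/andP; split; lra.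
Qed.

Lemma late_values_le r t v : 0 <= r -> 0 <= t -> late_values r t v -> 0 <= v <= a (r + 1).
Proof.
move=> r0 t0' [->|[p [t0 [t' [TTp t00 tt' ->]]]]].
  by rewrite lexx class_Kinf_ge0 // addr_ge0.
have /andP[c0 c1] := cutoff_itv (enorm (state p t0)) r.
have e0 := enorm_ge0 (state p t'); rewrite mulr_ge0 //=.
have r1 : 0 <= r + 1 by rewrite addr_ge0.
have [le|ge] := leP (r + 1) (enorm (state p t0)).
  by rewrite cutoff_eq0 // mulr0 class_Kinf_ge0.
apply: (@le_trans _ _ (enorm (state p t'))); first by rewrite ler_piMr.
apply: (@le_trans _ _ (a (enorm (state p t0)))).
  by apply: (stab TTp).2 => //; lra.
by apply: class_Kinf_le => //; [exact: enorm_ge0|exact: ltW].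
Qed.

Lemma late_sup_ub r t v : 0 <= r -> 0 <= t -> late_values r t v -> v <= late_sup r t.
Proof.
move=> r0 t0 Sv; apply: ub_le_sup => //; exists (a (r + 1)) => w Sw.
by have /andP[] := late_values_le r0 t0 Sw.
Qed.

Lemma late_sup_le r t B : (forall v, late_values r t v -> v <= B) -> late_sup r t <= B.
Proof. by move=> H; apply: ge_sup => //; exists 0; left. Qed.

Lemma late_sup_ge0 r t : 0 <= r -> 0 <= t -> 0 <= late_sup r t.
Proof. by move=> r0 t0; apply: late_sup_ub => //; left. Qed.

(** States started where the cutoff for [r'] is nonzero are bounded by [a (r' + 1)], which serves as
    Lipschitz constant. *)
Lemma late_sup_lipschitz r r' t : 0 <= r -> r <= r' -> 0 <= t ->
  late_sup r t <= late_sup r' t <= late_sup r t + a (r' + 1) * (r' - r).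
Proof.
move=> r0 rr' t0; have r'0 := le_trans r0 rr'; apply/andP; split; apply: late_sup_le => v.
  move=> [->|[p [s [s' [TTp s0 ss' ->]]]]]; first exact: late_sup_ge0.
  have /andP[c1 c2] := cutoff_le (enorm (state p s)) rr'.
  apply: (@le_trans _ _ (enorm (state p s') * cutoff (enorm (state p s)) r')).
    by rewrite ler_wpM2l // enorm_ge0.
  by apply: late_sup_ub => //; right; exists p, s, s'.
have a0 : 0 <= a (r' + 1) by apply: class_Kinf_ge0 => //; rewrite addr_ge0.
move=> [->|[p [s [s' [TTp s0 ss' ->]]]]].
  by rewrite addr_ge0 ?late_sup_ge0 // mulr_ge0 // subr_ge0.
have /andP[c1 c2] := cutoff_le (enorm (state p s)) rr'.
have [le|gt] := leP (r' + 1) (enorm (state p s)).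
  rewrite cutoff_eq0 // mulr0 addr_ge0 ?late_sup_ge0 // mulr_ge0 // subr_ge0 //.
have ea : enorm (state p s') <= a (r' + 1).
  apply: (@le_trans _ _ (a (enorm (state p s)))).
    by apply: (stab TTp).2 => //; lra.
  by apply: class_Kinf_le => //; [exact: enorm_ge0|exact: ltW].
apply: (@le_trans _ _ (enorm (state p s') * (cutoff (enorm (state p s)) r + (r' - r)))).
  by rewrite ler_wpM2l // enorm_ge0.
rewrite mulrDr; apply: lerD; last by rewrite ler_wpM2r // subr_ge0.
by apply: late_sup_ub => //; right; exists p, s, s'.
Qed.

Lemma late_sup_cont t r : 0 <= t -> 0 <= r -> cont_at `[0, +oo[ (late_sup ^~ t) r.
Proof.
move=> t0 r0 e e0.
have r2 : 0 <= r + 1 + 1 by rewrite !addr_ge0.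
have a0 := class_Kinf_ge0 Ka r2.
have C0 : 0 < a (r + 1 + 1) + 1 by rewrite ltr_wpDl.
exists (Num.min 1 (e / (a (r + 1 + 1) + 1))); first by rewrite lt_min ltr01 divr_gt0.
move=> u; rewrite /= in_itv /= andbT => u0; rewrite lt_min ltr_pdivlMr // => /andP[u1 ue].
have main p q : 0 <= p -> p <= q -> q <= r + 1 -> q - p = `|u - r| ->
    `|late_sup q t - late_sup p t| <= e.
  move=> p0 pq qr pqE; have /andP[l1 l2] := late_sup_lipschitz p0 pq t0.
  have q0 := le_trans p0 pq.
  have aq : a (q + 1) <= a (r + 1 + 1) by apply: class_Kinf_le; rewrite ?addr_ge0 ?lerD2r.
  rewrite ger0_norm ?subr_ge0 // lerBlDl; apply: le_trans l2 _; rewrite lerD2l pqE.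
  by have := normr_ge0 (u - r); nra.
have [ru|/ltW ur] := leP r u.
  by apply: main => //; [have := ler_norm (u - r); lra|rewrite ger0_norm // subr_ge0].
by rewrite distrC; apply: main => //; [lra|rewrite distrC ger0_norm // subr_ge0].
Qed.

Lemma late_sup_noninc r s t : 0 <= r -> 0 <= s -> s <= t -> late_sup r t <= late_sup r s.
Proof.
move=> r0 s0 st; apply: late_sup_le => v Sv; apply: late_sup_ub => //.
case: Sv => [->|[p [t0 [t' [TTp t00 tt' ->]]]]]; [by left|right].
by exists p, t0, t'; split=> //; lra.
Qed.

Lemma late_sup_small r e : 0 < e -> exists2 T, 0 <= T & forall t, T <= t ->
  late_sup r t <= e.
Proof.
move=> e0; have [T T0 TP] := attr (r + 1) e0; exists T => // t Tt.
apply: late_sup_le => v [->|[p [t0 [t' [TTp t00 tt' ->]]]]]; first exact: ltW.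
have [le|/ltW gt] := leP (r + 1) (enorm (state p t0)).
  by rewrite cutoff_eq0 // mulr0 ltW.
have /andP[c0 c1] := cutoff_itv (enorm (state p t0)) r.
apply: (@le_trans _ _ (enorm (state p t'))); first by rewrite ler_piMr // enorm_ge0.
by apply: TP TTp _ _ t00 gt _; lra.
Qed.

Lemma attractivity_KL : globally_uniformly_asymptotically_stable TT.
Proof.
(* The minimum with [a r] forces the value 0 at [r = 0], where [late_sup] may be positive since the
   cutoff reaches up to radius 1; [r / (1 + t)] adds strict growth and unboundedness in [r] and
   vanishes as [t] grows. *)
exists (fun r t => Num.min (a r) (late_sup r t) + r / (1 + t)); last first.
  move=> p TTp; have [domE bd] := stab TTp; split=> // t0 t t00 t0t.
  have t0' : 0 <= t - t0 by rewrite subr_ge0.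
  set r := enorm (state p t0).
  apply: (@le_trans _ _ (Num.min (a r) (late_sup r (t - t0)))); last first.
    by rewrite lerDl divr_ge0 ?enorm_ge0 // addr_ge0.
  rewrite le_min bd //=; apply: late_sup_ub => //; first exact: enorm_ge0.
  right; exists p, t0, t; split=> //; first by rewrite subrKC.
  by rewrite cutoff1 ?mulr1.
have a_cont r : 0 <= r -> cont_at `[0, +oo[ a r.
  by move=> r0; have [/within_continuousP ca _ _] := Ka.1; apply: ca; rewrite /= in_itv /= andbT.
split.
- move=> t t0; have t1 : 0 < 1 + t by rewrite ltr_pwDl.
  have ti : 0 < (1 + t)^-1 by rewrite invr_gt0.
  apply/class_KinfP; split.
  + move=> r r0 e e0; have e2 : 0 < e / 2 by rewrite divr_gt0.
    have [d1 d10 d1P] := a_cont r r0 _ e2.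
    have [d2 d20 d2P] := late_sup_cont t0 r0 e2.
    exists (Num.min (e / 2) (Num.min d1 d2)); first by rewrite !lt_min e2 d10.
    move=> u Iu; rewrite !lt_min => /and3P[ue ud1 ud2].
    have := d1P u Iu ud1; have := d2P u Iu ud2.
    have : `|u / (1 + t) - r / (1 + t)| <= e / 2.
      rewrite -mulrBl normrM (gtr0_norm ti); apply: le_trans (ltW ue).
      by rewrite ler_piMr // invf_le1 // lerDl.
    rewrite !ler_distl !minEle.
    by do ![case: ifPn; rewrite -?ltNge => ?];
      move=> /andP[? ?] /andP[? ?] /andP[? ?]; apply/andP; split; lra.
  + move=> r s r0 rs; rewrite ler_ltD //; last by rewrite ltr_pM2r.
    have /andP[l1 _] := late_sup_lipschitz r0 (ltW rs) t0.
    have := class_Kinf_le Ka r0 (ltW rs) => l2.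
    by rewrite le_min !ge_min l1 l2 orbT.
  + by have [[_ _ ->] _] := Ka; rewrite mul0r addr0 min_l // late_sup_ge0.
  + move=> B; exists ((`|B| + 1) * (1 + t)); first by rewrite mulr_ge0 ?addr_ge0 // ltW.
    rewrite mulfK ?gt_eqF //; apply: (@lt_le_trans _ _ (`|B| + 1)).
      by rewrite (le_lt_trans (ler_norm _)) // ltrDl.
    have r0 : 0 <= (`|B| + 1) * (1 + t) by rewrite mulr_ge0 ?addr_ge0 // ltW.
    by rewrite lerDr le_min late_sup_ge0 // class_Kinf_ge0.
- move=> r r0 s t s0 st; have t0 := le_trans s0 st.
  apply: lerD.
    by rewrite le_min !ge_min lexx (late_sup_noninc r0 s0 st) orbT.
  by rewrite ler_wpM2l // lef_pV2 ?posrE ?lerD2l // ltr_pwDl.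
- move=> r r0; apply/cvgrPdist_le => e e0; have e2 : 0 < e / 2 by rewrite divr_gt0.
  have [T T0 TP] := late_sup_small r e2.
  exists (Num.max T (r / (e / 2))); split; first exact: num_real.
  move=> t; rewrite gt_max => /andP[Tt rt]; have t0 : 0 <= t by apply: le_trans (ltW Tt).
  have t1 : 0 < 1 + t by rewrite ltr_pwDl.
  rewrite sub0r normrN.
  have m0 : 0 <= Num.min (a r) (late_sup r t) by rewrite le_min late_sup_ge0 // class_Kinf_ge0.
  have me : Num.min (a r) (late_sup r t) <= e / 2 by rewrite ge_min TP ?orbT // ltW.
  have re : r / (1 + t) <= e / 2.
    by rewrite ler_pdivrMr //; move: rt; rewrite ltr_pdivrMr //; nra.
  have rt0 : 0 <= r / (1 + t) by rewrite divr_ge0 // ltW.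
  by rewrite ger0_norm ?addr_ge0 //; lra.
Qed.

End ComparisonFunction.

Theorem theorem2p2 (R : realType) (n m : nat)
    (f : 'I_m -> 'rV[R]_n -> 'rV[R]_n)
    (hf : forall g, continuous (f g))
    (TT : set (trajectory R n m))
    (hTT : TT `<=` maximal_trajectories f)
    (chi : 'I_m -> set 'rV[R]_n)
    (hchi : closed_covering chi)
    (hTTchi : TT `<=` covered_trajectories f chi)
    (hf0 : forall g, chi g 0 -> f g 0 = 0)
    (hTTa : TT `<=` all_adt_trajectories f)
    (hV : exists2 V : 'I_m -> 'rV[R]_n -> R, weak_lyapunov_like f TT chi V &
      maximal_weakly_invariant
        (level_trajectories f setT V `&` covered_trajectories f chi
           `&` all_adt_trajectories f)
        ([set 0] `*` [set g | chi g 0])) :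
  globally_asymptotically_stable TT /\
  ((exists (tauD : R) (N0 : nat),
      [/\ 0 < tauD, (0 < N0)%N & TT `<=` adt_trajectories f tauD N0]) ->
   globally_uniformly_asymptotically_stable TT).
Proof.
have [V wV maxM] := hV.
have cV g : continuous (V g).
  by have [C1V _ _ _] := wV; move=> xi; apply: differentiable_continuous; case: (C1V g).
have closed_chi : forall g, closed (chi g) by case: hchi.
have mono := weak_lyapunov_like_monotone hTTchi wV.
have [a Ka stab] := weak_lyapunov_like_stable hf hTTchi wV.
have attr (TT' : set (trajectory R n m)) tau (N0 : nat) : 0 < tau -> (0 < N0)%N ->
    TT' `<=` TT -> TT' `<=` adt_trajectories f tau N0 ->
    forall r e, 0 < e -> exists2 T, 0 <= T & forall p, TT' p -> forall t0 t, 0 <= t0 ->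
      enorm (state p t0) <= r -> t0 + T <= t -> enorm (state p t) <= e.
  move=> tau0 N00 sub adt; apply: (uniform_attractivity hf closed_chi cV maxM tau0 N00 Ka) => //.
  - by move=> p /sub; exact: stab.
  - exact: subset_trans hTTchi.
  - exact: subset_trans mono.
split.
  split; first by exists a.
  move=> p TTp; have [tau [N0 [tau0 N00 adt]]] := hTTa p TTp.
  (* The constants [tau] and [N0] vary with the trajectory, so attractivity is applied to the family
     consisting of [p] alone. *)
  have adt1 : [set p] `<=` adt_trajectories f tau N0 by move=> _ ->.
  have sub1 : [set p] `<=` TT by move=> _ ->.
  apply/cvgrPdist_le => e e0.
  have [T T0 TP] := attr [set p] tau N0 tau0 N00 sub1 adt1 (enorm (state p 0)) e e0.
  exists T; split; first exact: num_real.
  move=> t /ltW Tt; rewrite sub0r normrN; apply: le_trans (norm_le_enorm _) _.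
  by apply: (TP p erefl 0 t) => //; rewrite add0r.
move=> [tau [N0 [tau0 N00 adt]]].
by apply: (attractivity_KL Ka stab); apply: (attr TT tau N0).
Qed.
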